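(* For any real $\nu\ge1$, the space $G_\nu$, with its Riemannian distance $\varrho$ and the measure $\bar\mu_\nu$, equipped with the family $\mathscr R_{\mathrm{ad}}$ of admissible sets, is a restrictive Calderón–Zygmund space satisfying condition (C).
   Context: $G_\nu=[0,\infty)\times\mathbb{R}$ with measure $d\bar\mu_\nu(x,u)=x^{\nu-1}\,dx\,du$ and distance $$\varrho((x,u),(x',u'))=\operatorname{arccosh}\Big(\cosh(u-u')+\frac{|x-x'|^2}{2e^{u+u'}}\Big).$$ For $m\in\mathbb{N}=\{0,1,2,\dots\}$, $l\in\mathbb{Z}$, $u\in\mathbb{R}$, $r>0$ let $R_{m,l,u,r}=[m2^l,(m+1)2^l)\times[u-r,u+r)$. $\mathscr R_{\mathrm{ad}}$ is the family of all $R_{m,l,u,r}$ with $e^u\sinh(2r)\le2^{l-1}<e^u\sinh(9r)$. A quasi-partition of a measurable set $E$ in a measure space is an at most countable family $\mathcal P$ of pairwise disjoint measurable subsets of $E$ such that $E\setminus\bigcup\mathcal P$ is negligible. A restrictive Calderón–Zygmund space is a metric-measure space $(X,d,\mu)$, $\mu$ a Radon measure, equipped with a family $\mathscr R$ of Borel subsets of $X$ (admissible sets) such that, for some $\kappa\in[1,\infty)$: (1) every $R\in\mathscr R$ has a centre $x(R)\in X$ and a radius $r(R)>0$ with $R\subseteq B_X(x(R),\kappa r(R))$ (open ball); (2) $0<\mu(R^* )\le\kappa\mu(R)<\infty$ for all $R\in\mathscr R$, where $R^*=\{x\in X: d(x,R)<r(R)\}$; (3) to each $R\in\mathscr R$ is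 associated a collection $\mathscr C(R)\subseteq\mathscr R$ of children of $R$, which is a quasi-partition of $R$ with $\#\mathscr C(R)\le\kappa$ and $\mu(R)\le\kappa\mu(R')$ for all $R'\in\mathscr C(R)$; set $\mathscr C^0(R)=\{R\}$, $\mathscr C^{n+1}(R)=\bigcup_{R'\in\mathscr C^n(R)}\mathscr C(R')$, and call the elements of $\bigcup_{n\in\mathbb N}\mathscr C^n(R)$ descendants of $R$; (4) for all $\varepsilon>0$ and $R\in\mathscr R$, and almost all $x\in R$, there is a descendant $R'$ of $R$ with $x\in R'$ and $r(R')\le\varepsilon$; (5) for all $\lambda\in(0,\mu(X))$ there is a quasi-partition $\mathcal P\subseteq\mathscr R$ of $X$ with $\mu(R)>\lambda$ for all $R\in\mathcal P$. It satisfies condition (C) if there is a subfamily $\mathscr R'\subseteq\mathscr R$ such that each $R\in\mathscr R$ is contained in some $R'\in\mathscr R'$, and if two sets of $\mathscr R'$ are not disjoint, then one is contained in the other. *)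

(* Defs.v *)
From HB Require Import structures.
From mathcomp Require Import all_boot all_order all_algebra.
From mathcomp Require Import all_classical all_reals all_analysis.
From mathcomp Require Import measurable_realfun.
From mathcomp Require Import ring lra.

Set Implicit Arguments.
Unset Strict Implicit.
Unset Printing Implicit Defensive.

Import Order.TTheory GRing.Theory Num.Theory.
Import numFieldNormedType.Exports.

Local Open Scope classical_set_scope.
Local Open Scope ring_scope.

(* Measurable types of the library are pointed, hence so are the spaces here. *)
#[short(type="pmetricType")]
HB.structure Definition PointedMetric (R : numDomainType) :=
  {T of Pointed T & Metric R T}.

Notation borelType T := (g_sigma_algebraType (@open T)).

Section calderon_zygmund.
Context {R : realType} {X : pmetricType R}.
Variable mu : {measure set (borelType X) -> \bar R}.
Implicit Types (A E : set X) (adm P : set (set X)).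

Definition radon_measure : Prop :=
  [/\ forall K : set X, compact K -> (mu K < +oo)%E,
      forall A, measurable (A : set (borelType X)) ->
        mu A = ereal_inf [set mu U | U in [set U : set X | open U /\ A `<=` U]]
    & forall U : set X, open U ->
        mu U = ereal_sup [set mu K | K in [set K : set X | compact K /\ K `<=` U]]].

Definition quasi_partition E P : Prop :=
  [/\ countable P,
      trivIset P id,
      forall A, P A -> measurable (A : set (borelType X)) /\ A `<=` E
    & mu.-negligible (E `\` \bigcup_(A in P) A)].

Fixpoint generation (children : set X -> set (set X)) (n : nat) A
    : set (set X) :=
  if n is n'.+1 then \bigcup_(B in generation children n' A) children B
  else [set A].

Definition descendants (children : set X -> set (set X)) A : set (set X) :=
  \bigcup_n generation children n A.

(* edist_inf A is the distance to the set A. *)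
Definition enlargement (rad : set X -> R) A : set X :=
  [set x | (edist_inf A x < (rad A)%:E)%E].

Record cz_axioms adm (kappa : R) (center : set X -> X) (rad : set X -> R)
    (children : set X -> set (set X)) : Prop := CZAxioms {
  cz_rad_gt0 : forall A, adm A -> 0 < rad A ;
  cz_sub_ball : forall A, adm A -> A `<=` ball (center A) (kappa * rad A) ;
  cz_doubling : forall A, adm A ->
    [/\ (0 < mu (enlargement rad A))%E,
        (mu (enlargement rad A) <= kappa%:E * mu A)%E
      & (kappa%:E * mu A < +oo)%E] ;
  cz_children : forall A, adm A ->
    [/\ children A `<=` adm,
        quasi_partition A (children A),
        exists n : nat, (children A #= `I_n)%card /\ n%:R <= kappa
      & forall B, children A B -> (mu A <= kappa%:E * mu B)%E] ;
  cz_small_descendants : forall (eps : R) A, 0 < eps -> adm A ->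
    {ae mu, forall x : borelType X, A x ->
      exists B, [/\ descendants children A B, B x & rad B <= eps]} ;
  cz_large_partition : forall lambda : R, 0 < lambda ->
    (lambda%:E < mu [set: X])%E ->
    exists P, [/\ P `<=` adm, quasi_partition [set: X] P
      & forall A, P A -> (lambda%:E < mu A)%E] }.

Definition restrictive_cz_space adm : Prop :=
  [/\ radon_measure,
      adm `<=` (measurable : set (set (borelType X)))
    & exists kappa center rad children,
        1 <= kappa /\ cz_axioms adm kappa center rad children].

Definition condition_C adm : Prop :=
  exists adm' : set (set X),
    [/\ adm' `<=` adm,
        forall A, adm A -> exists2 B, adm' B & A `<=` B
      & forall A B, adm' A -> adm' B -> A `&` B !=set0 ->
          A `<=` B \/ B `<=` A].

End calderon_zygmund.

Section hyperbolic_functions.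
Context {R : realType}.

Definition cosh (x : R) : R := (expR x + expR (- x)) / 2.
Definition sinh (x : R) : R := (expR x - expR (- x)) / 2.
(* The inverse of cosh on [0, +oo[, for arguments at least 1. *)
Definition arccosh (y : R) : R := ln (y + Num.sqrt (y ^+ 2 - 1)).

Lemma arccosh1 : arccosh 1 = 0.
Proof. by rewrite /arccosh expr1n subrr sqrtr0 addr0 ln1. Qed.

Lemma arccosh_arg_ge1 (y : R) : 1 <= y -> 1 <= y + Num.sqrt (y ^+ 2 - 1).
Proof. by move=> y1; rewrite -[leLHS]addr0 lerD// sqrtr_ge0. Qed.

Lemma arccosh_eq0 (y : R) : 1 <= y -> arccosh y = 0 -> y = 1.
Proof.
move=> y1; rewrite /arccosh -ln1 => /ln_inj.
have z1 := arccosh_arg_ge1 y1.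
rewrite !posrE => /(_ (lt_le_trans ltr01 z1) ltr01) e.
by have := sqrtr_ge0 (y ^+ 2 - 1); lra.
Qed.

Lemma ler_arccosh (y z : R) : 1 <= y -> y <= z -> arccosh y <= arccosh z.
Proof.
move=> y1 yz; have z1 := le_trans y1 yz.
have y1' := arccosh_arg_ge1 y1; have z1' := arccosh_arg_ge1 z1.
rewrite ler_ln ?posrE ?(lt_le_trans ltr01)// lerD// ler_wsqrtr// lerB//.
by rewrite ler_sqr ?nnegrE//; lra.
Qed.

Lemma arccoshD (a b : R) : 1 <= a -> 1 <= b ->
  arccosh (a * b + Num.sqrt (a ^+ 2 - 1) * Num.sqrt (b ^+ 2 - 1)) =
  arccosh a + arccosh b.
Proof.
move=> a1 b1; have a1' := arccosh_arg_ge1 a1; have b1' := arccosh_arg_ge1 b1.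
rewrite /arccosh -lnM ?posrE ?(lt_le_trans ltr01)//; congr ln.
have ha : Num.sqrt (a ^+ 2 - 1) ^+ 2 = a ^+ 2 - 1.
  by rewrite sqr_sqrtr//; nra.
have hb : Num.sqrt (b ^+ 2 - 1) ^+ 2 = b ^+ 2 - 1.
  by rewrite sqr_sqrtr//; nra.
have := sqrtr_ge0 (a ^+ 2 - 1); have := sqrtr_ge0 (b ^+ 2 - 1).
move: (Num.sqrt (a ^+ 2 - 1)) (Num.sqrt (b ^+ 2 - 1)) ha hb => s t ha hb t0 s0.
have -> : (a * b + s * t) ^+ 2 - 1 = (a * t + b * s) ^+ 2.
  rewrite !sqrrD !exprMn ha hb; ring.
rewrite sqrtr_sqr ger0_norm; first by ring.
by rewrite addr_ge0// mulr_ge0//; lra.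
Qed.

End hyperbolic_functions.

Definition Gspace (R : realType) : Type := {p : R * R | 0 <= p.1}.

Section Gspace_metric.
Context {R : realType}.
Implicit Types p q : Gspace R.

HB.instance Definition _ := Choice.on (Gspace R).
HB.instance Definition _ := isPointed.Build (Gspace R)
  (exist _ (0, 0) (lexx 0) : Gspace R).

(* Hyperbolic cosine of the distance, the point (x, u) of Gspace being written
   p with p.1 = x and p.2 = u. *)
Definition cosh_rho (p q : R * R) : R :=
  cosh (p.2 - q.2) + `|p.1 - q.1| ^+ 2 / (2 * expR (p.2 + q.2)).

Definition rho p q : R := arccosh (cosh_rho (val p) (val q)).

Lemma cosh_rhoE (p q : R * R) : let x := expR p.2 in let y := expR q.2 in
  cosh_rho p q = (x ^+ 2 + y ^+ 2 + (p.1 - q.1) ^+ 2) / (2 * x * y).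
Proof.
move=> x y; have x0 : 0 < x := expR_gt0 _; have y0 : 0 < y := expR_gt0 _.
rewrite /cosh_rho /cosh opprB !expRD !expRN -/x -/y.
rewrite -normrX ger0_norm ?sqr_ge0//; field.
by rewrite ?gt_eqF.
Qed.

Lemma cosh_rho_ge1 (p q : R * R) : 1 <= cosh_rho p q.
Proof.
rewrite cosh_rhoE; set x := expR _; set y := expR _.
have x0 : 0 < x := expR_gt0 _; have y0 : 0 < y := expR_gt0 _.
have xy0 : 0 < 2 * x * y by rewrite !mulr_gt0.
rewrite ler_pdivlMr// mul1r -subr_ge0.
have -> : x ^+ 2 + y ^+ 2 + (p.1 - q.1) ^+ 2 - 2 * x * y =
          (x - y) ^+ 2 + (p.1 - q.1) ^+ 2 by ring.
by rewrite addr_ge0// sqr_ge0.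
Qed.

Lemma rhoxx p : rho p p = 0.
Proof.
rewrite /rho cosh_rhoE subrr expr0n addr0.
set x := expR _; have x0 : 0 < x := expR_gt0 _.
rewrite (_ : _ / _ = 1) ?arccosh1//; field; exact: lt0r_neq0.
Qed.

Lemma rho_positivity p q : rho p q = 0 -> p = q.
Proof.
move/(arccosh_eq0 (cosh_rho_ge1 _ _)); rewrite cosh_rhoE.
case: p q => [[a u] p0] [[b v] q0]/=.
set x := expR _; set y := expR _.
have x0 : 0 < x := expR_gt0 _; have y0 : 0 < y := expR_gt0 _.
have xy0 : 2 * x * y != 0 by rewrite !mulf_neq0// gt_eqF.
move/(congr1 ( *%R^~ (2 * x * y))); rewrite mul1r divfK//.
move/eqP; rewrite -subr_eq0.
have -> : x ^+ 2 + y ^+ 2 + (a - b) ^+ 2 - 2 * x * y =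
          (x - y) ^+ 2 + (a - b) ^+ 2 by ring.
rewrite paddr_eq0 ?sqr_ge0// !sqrf_eq0 !subr_eq0 => /andP[/eqP xy /eqP ab].
by apply/val_inj => /=; rewrite ab (expR_inj xy).
Qed.

Lemma rho_sym p q : rho p q = rho q p.
Proof.
rewrite /rho !cosh_rhoE; congr arccosh.
by congr (_ / _); ring.
Qed.

Lemma rho_triangle q p r : rho p r <= rho p q + rho q r.
Proof.
rewrite /rho -arccoshD ?cosh_rho_ge1// ler_arccosh ?cosh_rho_ge1//.
case: p q r => [[a u] ?] [[b v] ?] [[c w] ?]/=.
rewrite !cosh_rhoE/=; set x := expR u; set y := expR v; set z := expR w.
have x0 : 0 < x := expR_gt0 _; have y0 : 0 < y := expR_gt0 _.
have z0 : 0 < z := expR_gt0 _.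
pose s1 := (a - b) / x; pose s2 := (c - b) / z.
pose t1 := ((a - b) ^+ 2 + x ^+ 2 - y ^+ 2) / (2 * x * y).
pose t2 := ((c - b) ^+ 2 + z ^+ 2 - y ^+ 2) / (2 * z * y).
have nz : [&& x != 0, y != 0 & z != 0] by rewrite !gt_eqF.
case/and3P : nz => nx ny nz.
have -> : ((x ^+ 2 + y ^+ 2 + (a - b) ^+ 2) / (2 * x * y)) ^+ 2 - 1 =
          s1 ^+ 2 + t1 ^+ 2.
  by rewrite /s1 /t1; field; rewrite nx ny.
have -> : ((y ^+ 2 + z ^+ 2 + (b - c) ^+ 2) / (2 * y * z)) ^+ 2 - 1 =
          s2 ^+ 2 + t2 ^+ 2.
  by rewrite /s2 /t2; field; rewrite nz ny.
have -> : (x ^+ 2 + z ^+ 2 + (a - c) ^+ 2) / (2 * x * z) =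
  (x ^+ 2 + y ^+ 2 + (a - b) ^+ 2) / (2 * x * y) *
  ((y ^+ 2 + z ^+ 2 + (b - c) ^+ 2) / (2 * y * z)) - (s1 * s2 + t1 * t2).
  by rewrite /s1 /s2 /t1 /t2; field; rewrite nx ny nz.
rewrite lerD2l (le_trans (ler_norm _))// normrN -sqrtrM ?addr_ge0 ?sqr_ge0//.
rewrite -sqrtr_sqr ler_wsqrtr// -subr_ge0.
have -> : (s1 ^+ 2 + t1 ^+ 2) * (s2 ^+ 2 + t2 ^+ 2) - (s1 * s2 + t1 * t2) ^+ 2
          = (s1 * t2 - s2 * t1) ^+ 2 by ring.
exact: sqr_ge0.
Qed.

HB.instance Definition _ := isMetric.Build R (Gspace R)
  rhoxx rho_positivity rho_sym rho_triangle.

Lemma mdist_rho p q : mdist p q = rho p q.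
Proof. by []. Qed.

End Gspace_metric.

Section Gspace_measure.
Context {R : realType}.

Lemma cvg_cosh_rho (p : R * R) : cosh_rho p q @[q --> p] --> (1 : R).
Proof.
have -> : (1 : R) = cosh_rho p p.
  rewrite /cosh_rho /cosh !subrr normr0 expr0n mul0r addr0 oppr0 expR0; by field.
have cF (f : R * R -> R) : f q @[q --> p] --> f p ->
    expR (f q) @[q --> p] --> expR (f p).
  by move=> cf; apply: (cvg_comp _ _ cf); exact: continuous_expR.
have c2 : (q : R * R).2 @[q --> p] --> p.2 by exact: cvg_snd.
have c1 : (q : R * R).1 @[q --> p] --> p.1 by exact: cvg_fst.
rewrite /cosh_rho /cosh; apply: cvgD.
  apply: cvgM; last exact: cvg_cst.
  apply: cvgD; apply: cF; last apply: cvgN.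
    by apply: cvgB => //; exact: cvg_cst.
  by apply: cvgB => //; exact: cvg_cst.
apply: cvgM.
  apply: (continuous_cvg _ (@exprn_continuous _ 2 _)); apply: cvg_norm.
  by apply: cvgB => //; exact: cvg_cst.
apply: cvgV; first by rewrite mulf_neq0// gt_eqF// expR_gt0.
apply: cvgM; first exact: cvg_cst.
by apply: cF; apply: cvgD => //; exact: cvg_cst.
Qed.

Lemma cvg_rho (p : R * R) :
  arccosh (cosh_rho p q) @[q --> p] --> (0 : R).
Proof.
rewrite -[0](@arccosh1 R); apply: (cvg_comp _ _ (@cvg_cosh_rho p)).
rewrite /arccosh; apply: continuous_cvg.
  by apply: continuous_ln; rewrite expr1n subrr sqrtr0 addr0.
apply: cvgD; first exact: cvg_id.
apply: continuous_cvg; first exact: sqrt_continuous.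
apply: cvgB; last exact: cvg_cst.
exact: exprn_continuous.
Qed.

Let box (w : (rat * rat) * (rat * rat)) : set (R * R) :=
  `]ratr w.1.1, ratr w.1.2[ `*` `]ratr w.2.1, ratr w.2.2[.

Let rat_in_nbhs (a e : R) : 0 < e -> exists r s : rat,
  ratr r < a < ratr s /\
  forall b : R, ratr r < b < ratr s -> `|a - b| < e.
Proof.
move=> e0; have /rat_in_itvoo[r] : a - e / 2 < a by lra.
have /rat_in_itvoo[s] : a < a + e / 2 by lra.
rewrite !in_itv/= => /andP[s1 s2] /andP[r1 r2].
exists r, s; split; first by rewrite r2 s1.
by move=> b /andP[b1 b2]; rewrite ltr_norml; lra.
Qed.

Lemma measurable_val (A : set (borelType (Gspace R))) :
  measurable A ->
  measurable ((val : Gspace R -> R * R) @` A :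
                set (measurableTypeR R * measurableTypeR R)).
Proof.
pose H : set (R * R) := `[0, +oo[ `*` setT.
have HE p : H p -> 0 <= p.1.
  by case=> + _; rewrite /= in_itv/= andbT.
have EH (p : Gspace R) : H (val p).
  by split => //=; rewrite in_itv/= andbT; exact: (valP p).
have mH : measurable (H : set (measurableTypeR R * measurableTypeR R)).
  by apply: measurableX => //; exact: measurable_itv.
pose M : set (set (Gspace R)) := [set A |
  measurable ((val : Gspace R -> R * R) @` A :
                set (measurableTypeR R * measurableTypeR R))].
suff : <<s @open (Gspace R) >> `<=` M by exact.
apply: smallest_sub; first split.
- by rewrite /M/= image_set0.
- move=> B mB; rewrite /M/= (_ : _ @` _ = H `\` (val @` B)).
    exact: measurableD.
  apply/seteqP; split => [_ [p [_ nBp] <-]|p [Hp nBp]].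
    split; first exact: EH.
    by move=> [q Bq /val_inj qp]; apply: nBp; rewrite -qp.
  exists (exist _ p (HE _ Hp)) => //; split => // Bp.
  by apply: nBp; exists (exist _ p (HE _ Hp)).
- by move=> F mF; rewrite /M/= image_bigcup; exact: bigcupT_measurable.
move=> U oU; rewrite /M/=.
pose good := [set w | H `&` box w `<=` val @` U].
have -> : val @` U = \bigcup_w (if w \in good then H `&` box w else set0).
  apply/seteqP; split => [_ [p Up <-]|q [w _]]; last first.
    by case: ifPn => // /set_mem; exact.
  have /nbhs_ballP[e/= e0 peU] : nbhs p U by exact: open_nbhs_nbhs.
  have := @cvg_rho (val p); move/cvgrPdist_lt => /(_ e e0).
  case=> -[V1 V2]/= [/nbhs_ballP[d1/= d10 dV1] /nbhs_ballP[d2/= d20 dV2]] VE.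
  have [r1 [s1 [prs1 rs1]]] := rat_in_nbhs (val p).1 d10.
  have [r2 [s2 [prs2 rs2]]] := rat_in_nbhs (val p).2 d20.
  have gw : ((r1, s1), (r2, s2)) \in good.
    apply/mem_set => q [/HE Hq [/= q1 q2]].
    exists (exist _ q Hq) => //; apply: peU; rewrite ballEmdist/=.
    have /VE/= : (V1 `*` V2) q.
      split => /=.
        by apply: dV1; apply: rs1; move: q1; rewrite /= in_itv.
      by apply: dV2; apply: rs2; move: q2; rewrite /= in_itv.
    by rewrite sub0r normrN; exact/le_lt_trans/ler_norm.
  exists ((r1, s1), (r2, s2)) => //; rewrite gw; split; first exact: EH.
  by split; rewrite /= in_itv.
apply: countable_bigcupT_measurable; first exact: countableP.
move=> w; case: ifP => // _; apply: measurableI => //.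
by apply: measurableX; exact: measurable_itv.
Qed.

Definition mu_bar (nu : R) (A : set (borelType (Gspace R))) : \bar R :=
  (\int[lebesgue_measure \x lebesgue_measure]_(p in
      (val : Gspace R -> R * R) @` A) (p.1 `^ (nu - 1))%:E)%E.

Section mu_bar_measure.
Variable nu : R.

Let mu_bar0 : mu_bar nu set0 = 0%E.
Proof. by rewrite /mu_bar image_set0 integral_set0. Qed.

Let mu_bar_ge0 A : (0 <= mu_bar nu A)%E.
Proof. by apply: integral_ge0 => p _; rewrite lee_fin powR_ge0. Qed.

Let mu_bar_sigma_additive : semi_sigma_additive (mu_bar nu).
Proof.
move=> F mF tF mUF; rewrite /mu_bar image_bigcup ge0_integral_bigcup//=.
- apply: is_cvg_ereal_nneg_natsum_cond => n _ _; exact: mu_bar_ge0.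
- by move=> k; exact: measurable_val.
- apply/measurable_EFinP; apply: (@measurable_funS _ _ _ _ setT) => //.
  apply: (measurableT_comp (measurable_powR (nu - 1))).
  exact: measurable_fst.
- by move=> p _; rewrite lee_fin powR_ge0.
- move=> i j _ _ [_ [[p Fip <-] [q Fjq /val_inj qp]]].
  by apply: tF => //; exists p; split => //; rewrite -qp.
Qed.

HB.instance Definition _ := isMeasure.Build _ _ _ (mu_bar nu)
  mu_bar0 mu_bar_ge0 mu_bar_sigma_additive.

End mu_bar_measure.
End Gspace_measure.

Section admissible_rectangles.
Context {R : realType}.

Definition rectangle (m : nat) (l : int) (u r : R) : set (Gspace R) :=
  [set p | m%:R * 2 ^ l <= (val p).1 < m.+1%:R * 2 ^ l /\
           u - r <= (val p).2 < u + r].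

Definition adm_rectangles : set (set (Gspace R)) :=
  [set A | exists (m : nat) (l : int) (u r : R),
    [/\ 0 < r,
        expR u * sinh (2 * r) <= 2 ^ (l - 1) < expR u * sinh (9 * r)
      & A = rectangle m l u r]].

End admissible_rectangles.

(* Main.v *)
Require Import Defs.
From mathcomp Require Import all_boot all_order all_algebra.
From mathcomp Require Import all_classical all_reals all_analysis.
From mathcomp Require Import measurable_realfun.
From mathcomp Require Import ring lra.

Set Implicit Arguments.
Unset Strict Implicit.
Unset Printing Implicit Defensive.

Import Order.TTheory GRing.Theory Num.Theory.
Import numFieldNormedType.Exports.

Local Open Scope classical_set_scope.
Local Open Scope ring_scope.

(** Put y = e^u. Then rho is the hyperbolic distance between points (x, y) of
the upper half-plane, and an admissible rectangle is one whose half-width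
2^(l-1) lies between e^u sinh (2r) and e^u sinh (9r), the half-widths of the
hyperbolic balls of radii 2r and 9r centred at height u.

Radon property. The topology of rho is that of the closed half-plane, which is
exhausted by compact boxes of finite measure. A finite Borel measure on a
metric space squeezes every Borel set between a closed and an open set
([borel_squeezed]), and this passes to the exhaustion
([radon_of_exhaustion], [radon_mu_bar]).

Size of sets. As nu >= 1, the density x^(nu-1) is nondecreasing, so the mass of
a box is between its area times the density at its left end and its area times
the density at its right end ([mu_bar_le], [mu_bar_ge]). No integral has to be
computed: two boxes with comparable areas and comparable abscissas have
comparable masses ([mu_bar_compare]). For m = 0 the left end of a rectangle
is 0 and the lower bound is void, so it is applied to the right half of the
rectangle instead.

Enclosing ball and enlargement. The upper bound on the half-width puts a
rectangle inside a ball of radius 20 r ([rectangle_sub_ball]). By the lower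
bound, a point at distance less than r from the rectangle has its abscissa
within half a width of it, so the enlargement lies in a box twice as wide and
twice as high ([thickening_rectangle]).

Children. A rectangle is cut into two equal parts. It is cut in the variable u
(radius r / 2) if both parts are admissible; otherwise 2^(l-1) is at least
e^(u - r/2) sinh (9r/2), and the inequality
2 sinh (2r) <= e^(-r/2) sinh (9r/2) ([halving_ineq]) shows that the parts
obtained by cutting in the variable x are admissible. Cuts in x leave u and r
alone while dividing 2^l by 2, which the bound e^u sinh (2r) <= 2^(l-1) permits
only finitely many times; hence every point lies in a descendant of radius r / 2
([vertical_halving]), and by iteration in arbitrarily small ones.

Large partitions. All the rectangles needed satisfy u + 2r = n ln 2 with
l = n + 1 and are then admissible ([admissible_pow]), with mass at least 2r.
With a = N ln 2, the half-line u >= 0 is cut into strips of radius a, and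
u < 0 into strips of radii a, 3 a, 9 a, ... : for u going to -oo the radius must
grow, since a fixed radius would force the width, hence the mass, to vanish.

Condition (C). The rectangles with m = 0, u = 0, r = N ln 2, l = 2N + 1 are
admissible and form an increasing chain that exhausts the space
([condition_C_adm_rectangles]). *)

(** * Regularity of Borel measures on metric spaces *)

Section thickening.
Context {R : realType} {X : metricType R}.
Implicit Types (A : set X) (e : R).

Definition thickening e A : set X := \bigcup_(a in A) [set x | mdist x a < e].

Lemma open_thickening e A : open (thickening e A).
Proof.
apply: bigcup_open => a _; rewrite openE/= => x /= xa; apply/nbhs_ballP.
exists (e - mdist x a); first by rewrite /= subr_gt0.
move=> y; rewrite ballEmdist/= => xy.
have := metric_triangle y x a; rewrite (metric_sym y x); lra.
Qed.

Lemma sub_thickening e A : 0 < e -> A `<=` thickening e A.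
Proof. by move=> e0 a Aa; exists a => //=; rewrite mdistxx. Qed.

Lemma thickeningS e e' A : e <= e' -> thickening e A `<=` thickening e' A.
Proof. by move=> ee' x [a Aa xa]; exists a => //; apply: lt_le_trans ee'. Qed.

Lemma closed_bigcap_thickening A : closed A ->
  \bigcap_n thickening n.+1%:R^-1 A = A.
Proof.
move=> cA; apply/seteqP; split => [x xA|x Ax n _]; last first.
  by apply: sub_thickening.
apply: cA => B /nbhs_ballP[e/= e0 eB].
have [n _ ne] := near_infty_natSinv_lt (PosNum e0).
have [a Aa xa] := xA n I.
exists a; split => //; apply: eB; rewrite ballEmdist/=.
by apply: (lt_trans xa); apply: ne => /=.
Qed.

Lemma open_bigcup_thickening A : open A ->
  \bigcup_n ~` thickening n.+1%:R^-1 (~` A) = A.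
Proof.
move=> oA; rewrite -setC_bigcap closed_bigcap_thickening ?setCK//.
exact: open_closedC.
Qed.

End thickening.

Section continuity.
Context {R : realType} {X : metricType R}.

Lemma continuous_of_mdist (f : X -> R) :
  (forall p e, 0 < e -> exists2 d, 0 < d &
     forall q, mdist p q < d -> `|f p - f q| < e) -> continuous f.
Proof.
move=> h p; apply/cvgrPdist_lt => e /(h p)[d d0 hd]; apply/nbhs_ballP.
by exists d => // q; rewrite ballEmdist; exact: hd.
Qed.

End continuity.

Section borel.
Context {R : realType} {X : pmetricType R}.

Lemma open_borel (U : set X) : open U -> measurable (U : set (borelType X)).
Proof. exact: sub_sigma_algebra. Qed.

Lemma closed_borel (F : set X) : closed F -> measurable (F : set (borelType X)).
Proof.
by move=> cF; rewrite -(setCK F); apply: measurableC; apply: open_borel; exact: closed_openC.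
Qed.

Lemma enlargementE (rad : set X -> R) (A : set X) : 0 < rad A ->
  enlargement rad A = thickening (rad A) A.
Proof.
move=> r0; apply/seteqP; split => x.
  rewrite /enlargement/= /edist_inf => /ereal_inf_lt[_ [a Aa <-]].
  by move=> /edist_lt_ball; rewrite ballEmdist => xa; exists a.
move=> [a Aa /= xa]; rewrite /enlargement/= /edist_inf.
apply: (@le_lt_trans _ _ (mdist x a + (rad A - mdist x a) / 2)%:E).
  apply: (@le_trans _ _ (edist (x, a))); first by apply: ereal_inf_lbound; exists a.
  have d0 := mdist_ge0 x a; apply: edist_fin; first lra.
  by rewrite ballEmdist/=; lra.
rewrite lte_fin; lra.
Qed.
End borel.

Section finite_regularity.
Context {R : realType} {X : pmetricType R}.
Variable mu : {measure set (borelType X) -> \bar R}.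
Variable O : set X.
Hypotheses (mO : measurable (O : set (borelType X))) (Ofin : (mu O < +oo)%E).

Let squeezed (A : set X) := forall e : R, 0 < e -> exists F U : set X,
  [/\ closed F, open U, F `<=` A, A `<=` U & (mu (O `&` (U `\` F)) < e%:E)%E].

(** Continuity from above, which needs the set O of finite measure. *)
Lemma measure_lt_of_bigcap (G : (set X)^nat) (e : R) :
  (forall n, measurable (G n : set (borelType X))) ->
  nonincreasing_seq G -> (mu (O `&` \bigcap_n G n) < e%:E)%E ->
  exists n, (mu (O `&` G n) < e%:E)%E.
Proof.
move=> mG niG; apply: contraPP => /forallNP h; apply/negP; rewrite -leNgt.
have mOG n : measurable (O `&` G n : set (borelType X)) by exact: measurableI.
have niOG : nonincreasing_seq (fun n => O `&` G n).
  by move=> m n mn; apply/subsetPset; apply: setIS; apply/subsetPset; exact: niG.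
rewrite -bigcapIr; last by exists 0%N.
have c := @nonincreasing_cvg_mu _ (borelType X) _ mu (fun n => O `&` G n)
  (le_lt_trans (le_measure mu (mem_set (mOG 0%N)) (mem_set mO) (@subIsetl _ _ _)) Ofin) mOG
  (bigcapT_measurable mOG) niOG.
rewrite -(cvg_lim _ c)//; apply: lime_ge; first exact: cvgP c.
by apply: nearW => n /=; rewrite leNgt; apply/negP; exact: h.
Qed.

Let squeezed_open U : open U -> squeezed U.
Proof.
move=> oU e e0.
pose F n := ~` thickening (n.+1%:R^-1 : R) (~` U).
have oF n : open (thickening (n.+1%:R^-1 : R) (~` U)) by exact: open_thickening.
have [n nF] : exists n, (mu (O `&` (U `\` F n)) < e%:E)%E.
  apply: (@measure_lt_of_bigcap (fun n => U `\` F n)).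
  - move=> n; rewrite /F setDE setCK.
    by apply: measurableI; exact: open_borel.
  - move=> m n mn; apply/subsetPset; apply: setDS; apply: subsetC.
    by apply: thickeningS; rewrite lef_pV2 ?posrE// ler_nat.
  - under eq_bigcapr do rewrite setDE.
    rewrite bigcapIr; last by exists 0%N.
    by rewrite -setC_bigcup open_bigcup_thickening// setICr setI0 measure0 lte_fin.
exists (F n), U; split => //; first exact: open_closedC.
rewrite -[X in _ `<=` X](open_bigcup_thickening oU); exact: bigcup_sup.
Qed.

Let squeezedC A : squeezed A -> squeezed (~` A).
Proof.
move=> rA e e0; have [F [U [cF oU FA AU FU]]] := rA e e0.
exists (~` U), (~` F); split.
- exact: open_closedC.
- exact: closed_openC.
- exact: subsetC.
- exact: subsetC.
- suff -> : ~` F `\` ~` U = U `\` F by [].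
  by rewrite !setDE setCK setIC.
Qed.

Let squeezed_bigcup (A : (set X)^nat) :
  (forall n, squeezed (A n)) -> squeezed (\bigcup_n A n).
Proof.
move=> rA e e0.
have e2 n : 0 < e / 2 / (2 ^ n.+1)%:R by rewrite !divr_gt0// ltr0n expn_gt0.
have /choice[FU hFU] : forall n, exists FU : set X * set X,
  [/\ closed FU.1, open FU.2, FU.1 `<=` A n, A n `<=` FU.2 &
    (mu (O `&` (FU.2 `\` FU.1)) < (e / 2 / (2 ^ n.+1)%:R)%:E)%E].
  by move=> n; have [F [U FU]] := rA n _ (e2 n); exists (F, U).
pose F n := (FU n).1; pose U n := (FU n).2.
have cF n : closed (F n) by case: (hFU n).
have oU n : open (U n) by case: (hFU n).
have mF n : measurable (F n : set (borelType X)) by exact: closed_borel.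
have mU n : measurable (U n : set (borelType X)) by exact: open_borel.
have mUU : measurable (\bigcup_n U n : set (borelType X)).
  exact: bigcupT_measurable.
pose G n := \bigcup_n U n `\` \big[setU/set0]_(i < n) F i.
have [n nG] : exists n, (mu (O `&` G n) < e%:E)%E.
  apply: measure_lt_of_bigcap.
  - by move=> n; apply: measurableD => //; exact: bigsetU_measurable.
  - move=> m n mn; apply/subsetPset; apply: setDS.
    exact: subset_bigsetU.
  - apply: (@le_lt_trans _ _ (e / 2)%:E); last by rewrite lte_fin; lra.
    apply: (le_trans _ (@epsilon_trick0 _ (e / 2) xpredT _)); last by lra.
    apply: (le_trans (@measure_sigma_subadditive _ _ _ mu _
      (fun n => O `&` (U n `\` F n)) _ _ _)).
    + by move=> n; apply: measurableI => //; exact: measurableD.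
    + apply: measurableI => //; apply: bigcapT_measurable => n.
      by apply: measurableD => //; exact: bigsetU_measurable.
    + move=> x [Ox Gx]; have [[n _ Unx] _] := Gx 0%N I.
      exists n => //; split => //; split => // Fnx.
      have [_] := Gx n.+1 I; apply.
      by rewrite -bigcup_mkord; exists n => //=.
    + by apply: lee_nneseries => // n _; apply/ltW; case: (hFU n).
exists (\big[setU/set0]_(i < n) F i), (\bigcup_n U n); split => //.
- by rewrite -bigcup_mkord; apply: closed_bigcup => //; exact: finite_II.
- by apply: bigcup_open.
- rewrite -bigcup_mkord => x [i _ Fx]; exists i => //; by case: (hFU i) => _ _ + _ _; exact.
- move=> x [i _ Fx]; exists i => //; by case: (hFU i) => _ _ _ + _; exact.
Qed.

(** The sets that can be squeezed form a sigma-algebra. For countable unions, the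
union of the closed sets need not be closed, but finitely many of them suffice
up to a small mass; for open sets the closed sets are the complements of the
thickenings of the complement. *)
Lemma borel_squeezed (A : set X) (e : R) : 0 < e ->
  measurable (A : set (borelType X)) -> exists F U : set X,
  [/\ closed F, open U, F `<=` A, A `<=` U & (mu (O `&` (U `\` F)) < e%:E)%E].
Proof.
move=> e0 mA; suff : <<s @open X >> `<=` squeezed by move=> /(_ A mA e e0).
apply: smallest_sub; last exact: squeezed_open.
split.
- by apply: squeezed_open; exact: open0.
- by move=> B /squeezedC; rewrite setTD.
- exact: squeezed_bigcup.
Qed.

End finite_regularity.

Section radon_of_exhaustion.
Context {R : realType} {X : pmetricType R}.
Variable mu : {measure set (borelType X) -> \bar R}.
Variables K O : (set X)^nat.
Hypotheses (cK : forall n, compact (K n)) (ndK : nondecreasing_seq K).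
Hypotheses (oO : forall n, open (O n)) (OK : forall n, O n `<=` K n).
Hypotheses (O_cover : \bigcup_n O n = setT) (Kfin : forall n, (mu (K n) < +oo)%E).

Let closedK n : closed (K n).
Proof. by apply: compact_closed => //; exact: metric_hausdorff. Qed.

Let compact_fin C : compact C -> (mu C < +oo)%E.
Proof.
move=> cC; move: (cC); rewrite compact_cover.
move=> /(_ nat setT O (fun n _ => oO n)).
rewrite /cover O_cover => /(_ (@subsetT _ _))[D _ CD].
have {CD} CK : C `<=` K (\max_(i <- finmap.enum_fset D) i)%N.
  move=> x /CD[i /= iD /OK Kix].
  suff : K i `<=` K (\max_(i <- finmap.enum_fset D) i)%N by apply.
  by apply/subsetPset/ndK; exact: leq_bigmax_seq.
apply: le_lt_trans (Kfin (\max_(i <- finmap.enum_fset D) i)%N).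
have mC : measurable (C : set (borelType X)).
  by apply: closed_borel; apply: compact_closed => //; exact: metric_hausdorff.
apply: (le_measure mu (mem_set mC) _ CK); apply/mem_set; exact: closed_borel.
Qed.

Let outer_approx (A : set X) (e : R) : 0 < e ->
  measurable (A : set (borelType X)) ->
  exists U : set X, [/\ open U, A `<=` U & (mu U <= mu A + e%:E)%E].
Proof.
move=> e0 mA.
have e2 n : 0 < e / (2 ^ n.+1)%:R by rewrite !divr_gt0// ltr0n expn_gt0.
have mO n : measurable (O n : set (borelType X)) by exact: open_borel.
have Ofin n : (mu (O n) < +oo)%E.
  apply: le_lt_trans (Kfin n); apply: le_measure => //; apply/mem_set => //.
  exact: closed_borel.
have /choice[U hU] : forall n, exists U : set X, [/\ open U, A `<=` U &
    (mu (O n `&` (U `\` A)) <= (e / (2 ^ n.+1)%:R)%:E)%E].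
  move=> n.
  have [F [U [cF oU FA AU FU]]] := borel_squeezed (mO n) (Ofin n) (e2 n) mA.
  exists U; split => //; apply: (le_trans _ (ltW FU)).
  apply: le_measure; [apply/mem_set..|by apply: setIS; exact: setDS].
    by apply: measurableI => //; apply: measurableD => //; exact: open_borel.
  by apply: measurableI => //; apply: measurableD; [exact: open_borel|exact: closed_borel].
have mU n : measurable (U n : set (borelType X)).
  by apply: open_borel; case: (hU n).
pose V := \bigcup_n (O n `&` U n).
have mV : measurable (V : set (borelType X)).
  by apply: bigcupT_measurable => n; exact: measurableI.
have AV : A `<=` V.
  move=> x Ax; have : [set: X] x by [].
  rewrite -O_cover => -[n _ Onx]; exists n => //; split => //.
  by case: (hU n) => _ + _; exact.
exists V; split => //.
  by apply: bigcup_open => n _; apply: openI => //; case: (hU n).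
have -> : V = A `|` (V `\` A) by rewrite setDUK.
apply: (le_trans (measureU2 _ _ _)) => //; first exact: measurableD.
rewrite leeD2l//.
apply: (le_trans _ (@epsilon_trick0 _ e xpredT (ltW e0))).
apply: (le_trans (@measure_sigma_subadditive _ _ _ mu _
  (fun n => O n `&` (U n `\` A)) _ _ _)).
+ by move=> n; apply: measurableI => //; exact: measurableD.
+ exact: measurableD.
+ by move=> x [[n _ [Ox Ux]] nAx]; exists n.
+ by apply: lee_nneseries => // n _; case: (hU n).
Qed.

Let inner_exhaustion (U : set X) : open U -> exists C : (set X)^nat,
  [/\ forall n, compact (C n), forall n, C n `<=` U &
      mu (C n) @[n --> \oo] --> mu U].
Proof.
move=> oU.
pose C n := K n `&` ~` thickening (n.+1%:R^-1 : R) (~` U).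
have cC n : closed (C n).
  by apply: closedI => //; apply: open_closedC; exact: open_thickening.
have CU : \bigcup_n C n = U.
  apply/seteqP; split => x.
    move=> [n _ [_ nx]]; rewrite -(open_bigcup_thickening oU).
    by exists n.
  move=> Ux; have : [set: X] x by [].
  rewrite -O_cover => -[n _ /OK Knx].
  move: Ux; rewrite -{1}(open_bigcup_thickening oU) => -[m _ tmx].
  exists (maxn n m) => //; split.
    suff : K n `<=` K (maxn n m) by apply.
    by apply/subsetPset/ndK; exact: leq_maxl.
  apply: contra_not tmx; apply: thickeningS.
  by rewrite lef_pV2 ?posrE// ler_nat ltnS leq_maxr.
exists C; split.
- by move=> n; apply: (@subclosed_compact _ _ (K n)) => //; exact: subIsetl.
- by move=> n x Cnx; rewrite -CU; exists n.
rewrite -[X in _ --> mu X]CU.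
apply: (@nondecreasing_cvg_mu _ (borelType X) _ mu C).
- by move=> n; exact: closed_borel.
- by apply: bigcupT_measurable => n; exact: closed_borel.
- move=> m n mn; apply/subsetPset; apply: setISS.
    by apply/subsetPset; exact: ndK.
  by apply: subsetC; apply: thickeningS; rewrite lef_pV2 ?posrE// ler_nat.
Qed.

(** The two exhaustions play different roles: the open sets O turn the measure
into countably many finite ones and absorb a compact set in finitely many steps,
while the compact sets K cut the closed sets inside an open set down to compact
ones. *)
Lemma radon_of_exhaustion : radon_measure mu.
Proof.
split=> [||U oU].
- exact: compact_fin.
- move=> A mA; apply/eqP; rewrite eq_le; apply/andP; split.
    apply: le_ereal_inf_tmp => _ [U [oU AU] <-].
    by apply: le_measure => //; apply/mem_set => //; exact: open_borel.
  apply/lee_addgt0Pr => e e0; have [U [oU AU muU]] := outer_approx e0 mA.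
  by apply: le_trans muU; apply: ereal_inf_lbound; exists U.
- apply/eqP; rewrite eq_le; apply/andP; split.
    have [C [cC CU cvC]] := inner_exhaustion oU.
    rewrite -(cvg_lim _ cvC)//; apply: lime_le; first exact: cvgP cvC.
    by apply: nearW => n; apply: ereal_sup_ubound; exists (C n).
  apply: ge_ereal_sup => _ [C [cC CU] <-].
  apply: le_measure => //; apply/mem_set; last exact: open_borel.
  by apply: closed_borel; apply: compact_closed => //; exact: metric_hausdorff.
Qed.

End radon_of_exhaustion.

(** * Hyperbolic functions *)

Section hyperbolic.
Context {R : realType}.
Implicit Types s t x y : R.

Lemma cosh_ge1 t : 1 <= cosh t.
Proof.
rewrite /cosh expRN; have x0 := expR_gt0 t; move: (expR t) x0 => x x0.
rewrite -subr_ge0.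
have -> : (x + x^-1) / 2 - 1 = (x - 1) ^+ 2 / (2 * x) by field; rewrite gt_eqF.
by rewrite divr_ge0 ?sqr_ge0// mulr_ge0// ltW.
Qed.

Lemma coshN t : cosh (- t) = cosh t.
Proof. by rewrite /cosh opprK addrC. Qed.

Lemma cosh_norm t : cosh `|t| = cosh t.
Proof. by case: (ger0P t) => // _; rewrite coshN. Qed.

Lemma sinh_ge0 t : 0 <= t -> 0 <= sinh t.
Proof. by move=> t0; rewrite /sinh divr_ge0// subr_ge0 ler_expR; lra. Qed.

Lemma sinh_gt0 t : 0 < t -> 0 < sinh t.
Proof. by move=> t0; rewrite /sinh divr_gt0// subr_gt0 ltr_expR; lra. Qed.

Lemma cosh_sqrB1 t : cosh t ^+ 2 - 1 = sinh t ^+ 2.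
Proof.
rewrite /cosh /sinh expRN; have := expR_gt0 t.
by move: (expR t) => x x0; field; rewrite gt_eqF.
Qed.

Lemma coshD s t : cosh (s + t) = cosh s * cosh t + sinh s * sinh t.
Proof.
rewrite /cosh /sinh opprD !expRD !expRN; have := expR_gt0 t; have := expR_gt0 s.
by move: (expR t) (expR s) => x y x0 y0; field; rewrite !gt_eqF.
Qed.

Lemma arccosh_cosh t : 0 <= t -> arccosh (cosh t) = t.
Proof.
move=> t0; rewrite /arccosh cosh_sqrB1 sqrtr_sqr ger0_norm ?sinh_ge0//.
by rewrite -[RHS]expRK; congr ln; rewrite /cosh /sinh; lra.
Qed.

Lemma arccosh_ge0 y : 1 <= y -> 0 <= arccosh y.
Proof. by move=> y1; rewrite -(@arccosh1 R) ler_arccosh. Qed.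

Lemma lt_of_arccosh_lt y z : 1 <= y -> arccosh z < arccosh y -> z < y.
Proof.
by move=> y1; apply: contraTT; rewrite -!leNgt => yz; exact: ler_arccosh.
Qed.

Lemma ler_cosh s t : 0 <= s -> s <= t -> cosh s <= cosh t.
Proof.
move=> s0 st; rewrite leNgt; apply/negP => ts.
have := ler_arccosh (cosh_ge1 t) (ltW ts).
rewrite !arccosh_cosh//; last lra.
by move=> ts'; move: ts; rewrite (@le_anti _ _ s t) ?ltxx// st ts'.
Qed.

End hyperbolic.

Section hyperbolic_inequalities.
Context {R : realType}.
Implicit Types r s t : R.

Lemma sinh_double r : sinh (2 * r) = 2 * sinh r * cosh r.
Proof.
rewrite /sinh /cosh mulr_natl mulr2n opprD !expRD.
by move: (expR r) (expR (- r)) => x y; lra.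
Qed.

Lemma expR_le_cosh r : expR r <= 2 * cosh r.
Proof. by rewrite /cosh; have := expR_gt0 (- r); lra. Qed.

Lemma sinh_expR_le r : 0 <= r -> expR r * sinh r <= sinh (2 * r).
Proof.
move=> r0; have := expR_le_cosh r; have := sinh_ge0 r0.
by rewrite sinh_double; nra.
Qed.

Lemma sinh_le_expR r : sinh r <= expR r / 2.
Proof. by rewrite /sinh; have := expR_gt0 (- r); lra. Qed.

(** With s = e^r the inequality reads s^9 - 2 s^7 + 2 s^3 - 1 >= 0 for s >= 1. The
left side vanishes at s = 1, and its expansion in powers of s - 1 has
nonnegative coefficients. *)
Lemma halving_ineq r : 0 <= r ->
  2 * sinh (2 * r) <= expR (- (r / 2)) * sinh (9 * (r / 2)).
Proof.
move=> r0; rewrite /sinh.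
have s1 : 1 <= expR r by rewrite -[leLHS]expR0 ler_expR.
set s := expR r in s1; have s0 : s != 0 by rewrite gt_eqF; lra.
have -> : expR (- (r / 2)) * ((expR (9 * (r / 2)) - expR (- (9 * (r / 2)))) / 2)
        = (s ^+ 4 - s ^- 5) / 2.
  rewrite mulrA mulrBr -!expRD /s -!expRM_natl -expRN.
  by congr ((expR _ - expR _) / 2); rewrite !mulr_natl; lra.
have -> : expR (2 * r) = s ^+ 2 by rewrite /s -expRM_natl mulr_natl.
have -> : expR (- (2 * r)) = s ^- 2 by rewrite expRN /s -expRM_natl mulr_natl.
rewrite -subr_ge0.
have -> : (s ^+ 4 - s ^- 5) / 2 - 2 * ((s ^+ 2 - s ^- 2) / 2) =
    (s ^+ 9 - 2 * s ^+ 7 + 2 * s ^+ 3 - 1) / (2 * s ^+ 5) by field.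
rewrite divr_ge0//; last by rewrite mulr_ge0// exprn_ge0//; lra.
have [t t0 ->] : exists2 t, 0 <= t & s = 1 + t by exists (s - 1); lra.
have -> : (1 + t) ^+ 9 - 2 * (1 + t) ^+ 7 + 2 * (1 + t) ^+ 3 - 1 =
  t + 16 * t ^+ 3 + 56 * t ^+ 4 + 84 * t ^+ 5 + 70 * t ^+ 6 + 34 * t ^+ 7 +
  9 * t ^+ 8 + t ^+ 9 by ring.
by rewrite !addr_ge0// ?mulr_ge0// exprn_ge0.
Qed.

End hyperbolic_inequalities.

(** * Topology of the half-plane *)

Section Gspace_topology.
Context {R : realType}.
Implicit Types p q : Gspace R.

Lemma cosh_rho_lt p q (r : R) : 0 <= r -> mdist p q < r ->
  cosh_rho (val p) (val q) < cosh r.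
Proof.
move=> r0; rewrite mdist_rho /rho => pqr.
by apply: lt_of_arccosh_lt; rewrite ?arccosh_cosh// cosh_ge1.
Qed.

Lemma cosh_rho_ge_snd (p q : R * R) : cosh (p.2 - q.2) <= cosh_rho p q.
Proof.
by rewrite /cosh_rho lerDl divr_ge0 ?sqr_ge0// mulr_ge0// expR_ge0.
Qed.

(** The vertical segment between two heights is a geodesic, and the distance only
grows with the horizontal displacement. *)
Lemma snd_dist_le p q : `|(val p).2 - (val q).2| <= mdist p q.
Proof.
rewrite mdist_rho /rho -[leLHS]arccosh_cosh// ler_arccosh// cosh_norm ?cosh_ge1//.
exact: cosh_rho_ge_snd.
Qed.

Lemma continuous_Gsnd : continuous (fun p => (val p).2).
Proof.
apply: continuous_of_mdist => p e e0; exists e => // q.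
exact/le_lt_trans/snd_dist_le.
Qed.

(** On the ball of radius 1 the factor e^(u + u') is bounded, so the horizontal
displacement is controlled by cosh rho - 1. *)
Lemma continuous_Gfst : continuous (fun p => (val p).1).
Proof.
apply: continuous_of_mdist => p e e0.
set y := expR ((val p).2 + ((val p).2 + 1)).
have y0 : 0 < y := expR_gt0 _.
pose c := 1 + e ^+ 2 / (2 * y).
have c1 : 1 < c by rewrite ltrDl divr_gt0 ?exprn_gt0// mulr_gt0.
have ac0 : 0 < arccosh c.
  rewrite lt_neqAle arccosh_ge0 ?ltW// andbT eq_sym; apply/eqP => /arccosh_eq0.
  by lra.
exists (Num.min 1 (arccosh c)); first by rewrite /= lt_min ltr01.
move=> q; rewrite lt_min => /andP[pq1 pqc].
have : cosh_rho (val p) (val q) < c by apply: lt_of_arccosh_lt => //; exact: ltW.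
rewrite /cosh_rho /c => h.
have {h} := le_lt_trans (lerD (cosh_ge1 _) (lexx _)) h.
rewrite ltrD2l => h; rewrite -(@ltr_pXn2r _ 2) ?nnegrE// ?ltW//.
set z := expR _ in h; have z0 : 0 < z := expR_gt0 _.
have zy : z <= y.
  rewrite ler_expR lerD2l; have := snd_dist_le p q; rewrite ler_norml; lra.
move: h; rewrite ltr_pdivrMr ?mulr_gt0// => /lt_le_trans; apply.
rewrite (_ : e ^+ 2 / (2 * y) * (2 * z) = e ^+ 2 * (z / y)); last by field; rewrite gt_eqF.
by rewrite ler_piMr ?sqr_ge0// ler_pdivrMr// mul1r.
Qed.

(** A continuous retraction of the plane onto the half-plane, which transports
compactness from the plane. *)
Definition Gfold (p : R * R) : Gspace R := exist _ (`|p.1|, p.2) (normr_ge0 p.1).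

Lemma Gfold_val p : Gfold (val p) = p.
Proof. by apply: val_inj; case: p => -[x u] /= x0; rewrite ger0_norm. Qed.

Lemma continuous_Gfold : continuous Gfold.
Proof.
move=> p; apply/cvg_ballP => e e0.
have c : (`|q.1|, q.2) @[q --> p] --> (`|p.1|, p.2).
  apply: (@cvg_pair _ _ _ (nbhs p) (nbhs `|p.1|) (nbhs p.2)).
    by apply: cvg_norm; exact: cvg_fst.
  exact: cvg_snd.
have /cvgrPdist_lt/(_ e e0) := cvg_comp _ _ c (@cvg_rho R (`|p.1|, p.2)).
apply: filterS => q; rewrite sub0r normrN ballEmdist/= mdist_rho.
exact/le_lt_trans/ler_norm.
Qed.

Definition Gbox (a b c d : R) : set (Gspace R) :=
  [set p | a <= (val p).1 < b /\ c <= (val p).2 < d].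

Lemma measurable_Gbox a b c d :
  measurable (Gbox a b c d : set (borelType (Gspace R))).
Proof.
have mlt (f : Gspace R -> R) x : continuous f ->
    measurable ([set p | f p < x] : set (borelType (Gspace R))).
  move=> cf; apply: open_borel; exact: (open_comp (in1W cf) (@open_lt _ x)).
have mge (f : Gspace R -> R) x : continuous f ->
    measurable ([set p | x <= f p] : set (borelType (Gspace R))).
  move=> cf; rewrite (_ : [set _ | _] = ~` [set p | f p < x]).
    by apply: measurableC; exact: mlt.
  by apply/seteqP; split => p /=; rewrite leNgt => /negP.
rewrite (_ : Gbox a b c d =
    ([set p | a <= (val p).1] `&` [set p | (val p).1 < b]) `&`
    ([set p | c <= (val p).2] `&` [set p | (val p).2 < d])); last first.
  apply/seteqP; split => p /=; first by move=> [/andP[? ?] /andP[? ?]].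
  by move=> [[? ?] [? ?]]; split; apply/andP.
by apply: measurableI; apply: measurableI; (apply: mlt || apply: mge);
  (exact: continuous_Gfst || exact: continuous_Gsnd).
Qed.


Lemma compact_Gbox b c d : compact
  [set p : Gspace R | (val p).1 <= b /\ c <= (val p).2 <= d].
Proof.
rewrite (_ : [set _ | _] = Gfold @` (`[0, b] `*` `[c, d])).
  apply: continuous_compact.
    by apply: continuous_subspaceT; exact: continuous_Gfold.
  by apply: compact_setX; exact: segment_compact.
apply/seteqP; split => [p [pb pcd]|_ [[x u] /= [xb ucd] <-]].
  exists (val p); last exact: Gfold_val.
  by split; rewrite /= in_itv/= ?pcd// (valP p).
move: xb ucd; rewrite !in_itv/= => /andP[x0 xb] ucd.
by rewrite ger0_norm.
Qed.

End Gspace_topology.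

(** * The measure of boxes *)

Section mu_bar_bounds.
Context {R : realType}.
Variable nu : R.
Hypothesis nu1 : 1 <= nu.

Let leb2 := (@lebesgue_measure R \x @lebesgue_measure R)%E.

Let leb2_rect (a b c d : R) : a <= b -> c <= d ->
  leb2 (`[a, b[ `*` `[c, d[) = ((b - a) * (d - c))%:E.
Proof.
move=> ab cd; rewrite /leb2 product_measure1E//=; [|exact: measurable_itv..].
rewrite !lebesgue_measure_itv/= !lte_fin EFinM !EFinB.
case: ltP => [_|ba]; last by rewrite (@le_anti _ _ a b) ?ab ?ba// subee ?mul0e.
case: ltP => [_|dc] //; by rewrite (@le_anti _ _ c d) ?cd ?dc// subee ?mule0.
Qed.

Let measurable_density (D : set (R * R)) : measurable_fun D
  (fun p : measurableTypeR R * measurableTypeR R => (p.1 `^ (nu - 1))%:E).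
Proof.
apply/measurable_EFinP; apply: (@measurable_funS _ _ _ _ setT) => //.
by apply: (measurableT_comp (measurable_powR (nu - 1))); exact: measurable_fst.
Qed.

Lemma mu_bar_le (A : set (Gspace R)) (a b c d : R) :
  measurable (A : set (borelType (Gspace R))) ->
  0 <= b -> a <= b -> c <= d -> A `<=` Gbox a b c d ->
  (mu_bar nu A <= (b `^ (nu - 1) * ((b - a) * (d - c)))%:E)%E.
Proof.
move=> mA b0 ab cd AB; have mvA := measurable_val mA.
apply: (@le_trans _ _ (\int[leb2]_(p in val @` A) (b `^ (nu - 1))%:E)%E).
  apply: ge0_le_integral => //=.
  - by move=> p _; rewrite lee_fin powR_ge0.
  - exact: measurable_density.
  - move=> x [p Ap <-]; have [/andP[_ pb] _] := AB _ Ap; rewrite lee_fin.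
    by rewrite ge0_ler_powR ?nnegrE ?(valP p)// ?subr_ge0// ltW.
rewrite integral_cst// EFinM lee_wpmul2l ?lee_fin ?powR_ge0//.
rewrite -leb2_rect//; apply: le_measure; [exact: mem_set|apply/mem_set|].
  by apply: measurableX; exact: measurable_itv.
by move=> x [p Ap <-]; have [p1 p2] := AB _ Ap; split; rewrite /= in_itv.
Qed.

Lemma mu_bar_ge (A : set (Gspace R)) (a b c d : R) :
  measurable (A : set (borelType (Gspace R))) ->
  0 <= a -> a <= b -> c <= d -> Gbox a b c d `<=` A ->
  ((a `^ (nu - 1) * ((b - a) * (d - c)))%:E <= mu_bar nu A)%E.
Proof.
move=> mA a0 ab cd BA; have mvA := measurable_val mA.
have mB : measurable (`[a, b[ `*` `[c, d[ : set (measurableTypeR R * measurableTypeR R)).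
  by apply: measurableX; exact: measurable_itv.
have Bv : `[a, b[ `*` `[c, d[ `<=` val @` A.
  move=> p []; rewrite /= !in_itv/= => p1 p2.
  have p0 : 0 <= p.1 by case/andP: p1 => ap _; exact: le_trans ap.
  by exists (exist _ p p0) => //; apply: BA; split.
apply: (@le_trans _ _ (\int[leb2]_(p in `[a, b[ `*` `[c, d[) (p.1 `^ (nu - 1))%:E)%E).
  rewrite EFinM -leb2_rect// -integral_cst//.
  apply: ge0_le_integral => //=.
  - by move=> p _; rewrite lee_fin powR_ge0.
  - exact: measurable_density.
  - move=> p [/= + _]; rewrite in_itv/= => /andP[ap _].
    by rewrite lee_fin ge0_ler_powR ?nnegrE ?subr_ge0// (le_trans a0).
apply: ge0_subset_integral => //; first exact: measurable_density.
by move=> p _; rewrite lee_fin powR_ge0.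
Qed.

Lemma radon_mu_bar : radon_measure (mu_bar nu).
Proof.
pose K n := [set p : Gspace R | (val p).1 <= n%:R /\ - n%:R <= (val p).2 <= n%:R].
pose O n := [set p : Gspace R | (val p).1 < n%:R /\ `|(val p).2| < n%:R].
apply: (@radon_of_exhaustion _ _ _ K O).
- by move=> n; exact: compact_Gbox.
- move=> m n mn; apply/subsetPset => p [p1 p2].
  have mnR : (m%:R : R) <= n%:R by rewrite ler_nat.
  by rewrite /K/=; split; lra.
- move=> n; rewrite (_ : O n = [set p : Gspace R | (val p).1 < n%:R] `&`
    [set p : Gspace R | (val p).2 < n%:R] `&`  [set p : Gspace R | - n%:R < (val p).2]).
    apply: openI; first apply: openI.
    + exact: (open_comp (in1W continuous_Gfst) (@open_lt _ _)).
    + exact: (open_comp (in1W continuous_Gsnd) (@open_lt _ _)).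
    + exact: (open_comp (in1W continuous_Gsnd) (@open_gt _ _)).
  apply/seteqP; split => p; rewrite /O/= ltr_norml.
    by move=> [? /andP[? ?]].
  by move=> [[? ?] ?]; split => //; apply/andP.
- by move=> n p [/ltW p1]; rewrite ltr_norml => /andP[/ltW ? /ltW ?]; split => //; apply/andP.
- apply/seteqP; split => // p _.
  exists (Num.truncn ((val p).1 + `|(val p).2|)).+1 => //.
  have := truncnS_gt ((val p).1 + `|(val p).2|).
  have := valP p; have := normr_ge0 (val p).2 => /=.
  by move=> ? ? ?; split; lra.
- move=> n; apply: le_lt_trans (@mu_bar_le (K n) 0 (n%:R + 1) (- n%:R) (n%:R + 1) _ _ _ _ _) _.
  + by apply: closed_borel; apply: compact_closed; [exact: metric_hausdorff|exact: compact_Gbox].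
  + by rewrite addr_ge0.
  + by rewrite addr_ge0.
  + by have := ler0n R n; lra.
  + by move=> p [p1 p2]; have := valP p; move=> /= ?; split; lra.
  + exact: ltry.
Qed.

End mu_bar_bounds.

(** * Admissible rectangles *)

Section rectangles.
Context {R : realType}.
Implicit Types (m : nat) (l : int) (u r : R).

Lemma rectangleE m l u r :
  rectangle m l u r = Gbox (m%:R * 2 ^ l) (m.+1%:R * 2 ^ l) (u - r) (u + r).
Proof. by []. Qed.

Definition admissible m l u r :=
  0 < r /\ expR u * sinh (2 * r) <= 2 ^ (l - 1) < expR u * sinh (9 * r).

Lemma two_pow_gt0 l : 0 < 2 ^ l :> R.
Proof. exact: exprz_gt0. Qed.

Lemma two_powB1 l : 2 ^ (l - 1) = 2 ^ l / 2 :> R.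
Proof. by rewrite expfzDr. Qed.

Lemma Gbox_sub (a b c d a' b' c' d' : R) : 0 <= a -> a < b -> c < d ->
  Gbox a b c d `<=` Gbox a' b' c' d' -> [/\ a' <= a, b <= b', c' <= c & d <= d'].
Proof.
move=> a0 ab cd sub.
have H x y : a <= x < b -> c <= y < d -> a' <= x < b' /\ c' <= y < d'.
  move=> xab ycd; have x0 : 0 <= x by lra.
  by have /= := sub (exist _ (x, y) x0); apply; split.
have [/andP[a'a ab'] /andP[c'c cd']] := H a c ltac:(lra) ltac:(lra).
split=> //; rewrite leNgt; apply/negP => lt.
  by have [? _] := H b' c ltac:(lra) ltac:(lra); lra.
by have [_ ?] := H a d' ltac:(lra) ltac:(lra); lra.
Qed.

(** A rectangle determines its parameters, so that radius, centre and children can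
be defined on sets. *)
Lemma rectangle_inj m l u r m' l' u' r' : 0 < r -> 0 < r' ->
  rectangle m l u r = rectangle m' l' u' r' ->
  [/\ m = m', l = l', u = u' & r = r'].
Proof.
move=> r0 r'0 e; have w0 := two_pow_gt0 l; have w'0 := two_pow_gt0 l'.
have sub (m1 m2 : nat) (l1 l2 : int) (u1 u2 r1 r2 : R) : 0 < r1 ->
    rectangle m1 l1 u1 r1 `<=` rectangle m2 l2 u2 r2 ->
    [/\ m2%:R * 2 ^ l2 <= m1%:R * 2 ^ l1 :> R,
    m1.+1%:R * 2 ^ l1 <= m2.+1%:R * 2 ^ l2 :> R, u2 - r2 <= u1 - r1 & u1 + r1 <= u2 + r2].
  move=> r10; have w10 := two_pow_gt0 l1; rewrite !rectangleE => /Gbox_sub; apply.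
  - by rewrite mulr_ge0// ltW.
  - by rewrite ltr_pM2r// ltr_nat.
  - lra.
have [h1 h2 h3 h4] := sub _ _ _ _ _ _ _ _ r0 (subsetW e).
have [k1 k2 k3 k4] := sub _ _ _ _ _ _ _ _ r'0 (subsetW (esym e)).
have ww : 2 ^ l = 2 ^ l' :> R.
  by move: h1 h2 k1 k2; rewrite -(natr1 m) -(natr1 m') !mulrDl !mul1r; lra.
have ll : l = l' by apply: (@ieexprIz R 2) => //; lra.
split; [|by []|lra|lra].
move: h1 k1; rewrite ww !ler_pM2r// !ler_nat => m'm mm'.
by apply/eqP; rewrite eqn_leq mm' m'm.
Qed.

Definition rect_center m l u : Gspace R := Gfold ((m%:R + 1/2) * 2 ^ l, u).

(** The displacement from the centre contributes at most sinh(9r)^2 cosh r to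
cosh rho, and cosh r + sinh(9r)^2 cosh r = cosh(9r)^2 cosh r <= cosh(19r). *)
Lemma rectangle_sub_ball m l u r : admissible m l u r ->
  rectangle m l u r `<=` ball (rect_center m l u) (20 * r).
Proof.
move=> [r0 /andP[_ wle]] p [/andP[p1 p2] /andP[p3 p4]].
rewrite ballEmdist/= mdist_rho /rho.
apply: (@le_lt_trans _ _ (19 * r)); last lra.
rewrite -[leRHS]arccosh_cosh; last lra.
apply: ler_arccosh; first exact: cosh_rho_ge1.
rewrite /cosh_rho /= [`|_ * _|]ger0_norm; last by rewrite mulr_ge0 ?addr_ge0// ltW// two_pow_gt0.
set x := (val p).1 in p1 p2 *; set v := (val p).2 in p3 p4 *.
have hx : `|(m%:R + 1 / 2) * 2 ^ l - x| ^+ 2 <= (expR u * sinh (9 * r)) ^+ 2.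
  rewrite lerXn2r ?nnegrE//; first by rewrite mulr_ge0 ?expR_ge0 ?sinh_ge0//; lra.
  move: wle p1 p2; rewrite two_powB1 -(natr1 m) !mulrDl => wle p1 p2.
  by rewrite ler_norml; lra.
have hc : cosh (u - v) <= cosh r.
  rewrite -cosh_norm; apply: ler_cosh => //; rewrite ler_norml; lra.
have s2 : `|(m%:R + 1 / 2) * 2 ^ l - x| ^+ 2 / (2 * expR (u + v)) <=
    sinh (9 * r) ^+ 2 * cosh r.
  rewrite ler_pdivrMr ?mulr_gt0 ?expR_gt0//; apply: le_trans hx _.
  rewrite exprMn mulrC.
  rewrite [leRHS](_ : _ = sinh (9 * r) ^+ 2 * (expR (u + v) * (2 * cosh r))); last ring.
  rewrite ler_wpM2l ?sqr_ge0//.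
  have -> : expR u ^+ 2 = expR (u + v) * expR (u - v).
    by rewrite -expRD -expRM_natl mulr_natl; congr expR; lra.
  rewrite ler_pM2l ?expR_gt0//; apply: le_trans (expR_le_cosh r).
  by rewrite ler_expR; lra.
apply: le_trans (lerD hc s2) _.
have -> : cosh r + sinh (9 * r) ^+ 2 * cosh r = cosh (9 * r) ^+ 2 * cosh r.
  by rewrite -cosh_sqrB1; ring.
have -> : 19 * r = (9 * r + 9 * r) + r by ring.
rewrite coshD; have c1 := cosh_ge1 r.
have ss : 0 <= sinh (9 * r + 9 * r) * sinh r.
  by rewrite mulr_ge0// sinh_ge0//; lra.
have sc : 0 <= sinh (9 * r) ^+ 2 * cosh r by rewrite mulr_ge0 ?sqr_ge0//; lra.
by rewrite coshD; lra.
Qed.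

(** If points of heights u' and u' + t are at distance less than r, their squared
horizontal displacement is less than e^(2u') (2 e^t cosh r - e^(2t) - 1), which
is at most e^(2u') sinh(r)^2, the maximum being at e^t = cosh r.
Moreover e^(u+r) sinh r <= e^u sinh(2r), which is at most the half-width. *)
Lemma thickening_rectangle m l u r : admissible m l u r ->
  thickening r (rectangle m l u r) `<=`
    Gbox ((m%:R - 1/2) * 2 ^ l) ((m%:R + 3/2) * 2 ^ l) (u - 2 * r) (u + 2 * r).
Proof.
move=> [r0 /andP[wge _]] p [a [/andP[a1 a2] /andP[a3 a4]] /= pa].
have := cosh_rho_lt (ltW r0) pa; have := snd_dist_le p a.
rewrite /cosh_rho; set x := (val p).1; set v := (val p).2.
set y := (val a).1 in a1 a2 *; set t := (val a).2 in a3 a4 *.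
move=> /le_lt_trans/(_ pa) vt.
rewrite -ltrBrDl ltr_pdivrMr ?mulr_gt0 ?expR_gt0// => xy2.
have xy2' : `|x - y| ^+ 2 < (expR t * sinh r) ^+ 2.
  apply: lt_le_trans xy2 _.
  rewrite exprMn -cosh_sqrB1.
  have -> : expR (v + t) = expR t ^+ 2 * expR (v - t).
    by rewrite -expRM_natl -expRD mulr_natl; congr expR; lra.
  rewrite /cosh (expRN (v - t)); set z := expR (v - t); set c := (_ + expR (- r)) / 2.
  have z0 : 0 < z := expR_gt0 _.
  have -> : (c - (z + z^-1) / 2) * (2 * (expR t ^+ 2 * z)) =
    expR t ^+ 2 * (2 * z * c - z ^+ 2 - 1) by field; rewrite gt_eqF.
  rewrite ler_pM2l ?exprn_gt0 ?expR_gt0//.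
  by have := sqr_ge0 (z - c); lra.
have hw : expR t * sinh r <= 2 ^ l / 2.
  rewrite -two_powB1; apply: le_trans wge.
  apply: (@le_trans _ _ (expR (u + r) * sinh r)).
    by rewrite ler_wpM2r ?sinh_ge0 ?ler_expR// ltW.
  by rewrite expRD -mulrA ler_pM2l ?expR_gt0// sinh_expR_le// ltW.
have : `|x - y| < 2 ^ l / 2.
  apply: lt_le_trans hw; rewrite -(@ltr_pXn2r _ 2) ?nnegrE//.
  by rewrite mulr_ge0 ?expR_ge0 ?sinh_ge0// ltW.
move: a1 a2 vt; rewrite -(natr1 m) !ltr_norml /Gbox/= !mulrDl !mul1r mulNr; move: (2 ^ l) => w.
move=> a1 a2 vt xy; split; lra.
Qed.

End rectangles.

(** * Children and descendants *)

Section descendants.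
Context {R : realType} {X : pmetricType R}.
Variable children : set X -> set (set X).
Implicit Types A B C : set X.

Lemma descendants_refl A : descendants children A A.
Proof. by exists 0%N. Qed.

Lemma descendants_child A B : children A B -> descendants children A B.
Proof. by move=> AB; exists 1%N => //; exists A. Qed.

Lemma descendants_trans A B C : descendants children A B ->
  descendants children B C -> descendants children A C.
Proof.
move=> [n _ nAB] [k _]; elim: k C => [C /= -> |k IH C /= [D kBD DC]].
  by exists n.
by have [j _ jAD] := IH _ kBD; exists j.+1 => //; exists D.
Qed.

End descendants.

Section bisection.
Context {R : realType}.
Implicit Types (m : nat) (l : int) (u r : R).

(** The upper admissibility bound for the lower of the two halves in u; it is the
only one that a cut in u can violate. *)
Definition halves_vertically l u r : bool :=
  2 ^ (l - 1) < expR (u - r / 2) * sinh (9 * (r / 2)).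

Definition first_half m l u r : set (Gspace R) :=
  if halves_vertically l u r then rectangle m l (u - r / 2) (r / 2)
  else rectangle m.*2 (l - 1) u r.

Definition second_half m l u r : set (Gspace R) :=
  if halves_vertically l u r then rectangle m l (u + r / 2) (r / 2)
  else rectangle m.*2.+1 (l - 1) u r.

Lemma admissible_vertical_half m l u r v : admissible m l u r ->
  halves_vertically l u r -> u - r / 2 <= v <= u + r / 2 ->
  admissible m l v (r / 2).
Proof.
move=> [r0 /andP[h1 h2]] hv /andP[uv vu]; split; first lra.
apply/andP; split.
  apply: le_trans h1.
  have -> : 2 * (r / 2) = r by lra.
  apply: (@le_trans _ _ (expR (u + r) * sinh r)).
    by rewrite ler_wpM2r ?sinh_ge0 ?ler_expR//; lra.
  by rewrite expRD -mulrA ler_pM2l ?expR_gt0// sinh_expR_le// ltW.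
apply: (lt_le_trans hv).
by rewrite ler_wpM2r ?sinh_ge0 ?ler_expR//; lra.
Qed.

Lemma admissible_horizontal_half m m' l u r : admissible m l u r ->
  ~~ halves_vertically l u r -> admissible m' (l - 1) u r.
Proof.
move=> [r0 /andP[h1 h2]]; rewrite /halves_vertically -leNgt => hv; split => //.
have w0 : 0 < 2 ^ (l - 1) :> R := two_pow_gt0 _.
rewrite two_powB1; apply/andP; split; last by apply: le_lt_trans h2; lra.
have := ler_wpM2l (expR_ge0 u) (halving_ineq (ltW r0)).
by move: hv; rewrite expRD; lra.
Qed.

Lemma halves_admissible m l u r : admissible m l u r ->
  adm_rectangles (first_half m l u r) /\ adm_rectangles (second_half m l u r).
Proof.
move=> a; have r0 : 0 < r by case: a.
rewrite /first_half /second_half; case: ifPn => hv.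
  split.
  - have [] := @admissible_vertical_half _ _ _ _ (u - r / 2) a hv ltac:(lra).
    by exists m, l, (u - r / 2), (r / 2).
  - have [] := @admissible_vertical_half _ _ _ _ (u + r / 2) a hv ltac:(lra).
    by exists m, l, (u + r / 2), (r / 2).
split.
- have [] := @admissible_horizontal_half _ m.*2 _ _ _ a hv.
  by exists m.*2, (l - 1), u, r.
- have [] := @admissible_horizontal_half _ m.*2.+1 _ _ _ a hv.
  by exists m.*2.+1, (l - 1), u, r.
Qed.

Lemma setU_halves m l u r : 0 < r ->
  first_half m l u r `|` second_half m l u r = rectangle m l u r.
Proof.
move=> r0; rewrite /first_half /second_half; case: ifPn => hv; rewrite !rectangleE.
  apply/seteqP; split => p.
    by move=> [] [? /andP[? ?]]; split => //; lra.
  move=> [? /andP[? ?]]; have [] := leP u (val p).2; [right|left]; split => //; lra.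
have w0 := @two_pow_gt0 R l.
have mw : m%:R * 2 ^ l = m.*2%:R * (2 ^ l / 2) :> R by rewrite -muln2 natrM; lra.
have nw : m.+1%:R * 2 ^ l = m.*2.+2%:R * (2 ^ l / 2) :> R.
  by rewrite -doubleS -muln2 natrM; lra.
rewrite two_powB1 mw nw.
have h1 : m.*2%:R * (2 ^ l / 2) <= m.*2.+1%:R * (2 ^ l / 2) :> R.
  by rewrite ler_pM2r ?ler_nat//; lra.
have h2 : m.*2.+1%:R * (2 ^ l / 2) <= m.*2.+2%:R * (2 ^ l / 2) :> R.
  by rewrite ler_pM2r ?ler_nat//; lra.
apply/seteqP; split => p.
  by move=> [] [/andP[? ?] ?]; split => //; lra.
move=> [/andP[? ?] ?].
have [] := leP (m.*2.+1%:R * (2 ^ l / 2)) (val p).1; [right|left]; split => //; lra.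
Qed.

Lemma setI_halves m l u r :
  first_half m l u r `&` second_half m l u r = set0.
Proof.
rewrite -subset0 => p; rewrite /first_half /second_half; case: ifPn => hv.
  by move=> [[_ /andP[_ ?]] [_ /andP[? _]]]; rewrite /set0/=; lra.
by move=> [[/andP[_ ?] _] [/andP[? _] _]]; rewrite /set0/=; lra.
Qed.

Lemma adm_rectangle_neq0 (A : set (Gspace R)) : adm_rectangles A -> A !=set0.
Proof.
move=> [m [l [u [r [r0 _ ->]]]]]; have w0 := @two_pow_gt0 R l.
have e : (val (Gfold (m%:R * 2 ^ l, u))).1 = m%:R * 2 ^ l.
  by rewrite /= ger0_norm// mulr_ge0// ltW.
exists (Gfold (m%:R * 2 ^ l, u)); split; last by rewrite /=; lra.
by rewrite e lexx/= ltr_pM2r// ltr_nat.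
Qed.

Lemma measurable_rectangle m l u r :
  measurable (rectangle m l u r : set (borelType (Gspace R))).
Proof. exact: measurable_Gbox. Qed.

(** Induction on n: a cut in x divides 2^l by 2 and preserves u and r, so the
exponent n of the hypothesis decreases, and for n = 0 a cut in x is excluded by
the lower admissibility bound. *)
Lemma vertical_halving (children : set (Gspace R) -> set (set (Gspace R)))
  (n : nat) m l u r p :
  (forall m l u r, admissible m l u r ->
    children (rectangle m l u r) = [set first_half m l u r; second_half m l u r]) ->
  admissible m l u r -> rectangle m l u r p ->
  2 ^ (l - 1) < expR u * sinh (2 * r) * 2 ^+ n.+1 ->
  exists m' l' u', [/\ admissible m' l' u' (r / 2),
    descendants children (rectangle m l u r) (rectangle m' l' u' (r / 2)) &
    rectangle m' l' u' (r / 2) p].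
Proof.
move=> hch; elim: n m l => [|n IH] m l a mp hn.
all: have r0 : 0 < r by case: a.
all: have chl := hch _ _ _ _ a.
all: have : (first_half m l u r `|` second_half m l u r) p by rewrite setU_halves.
all: rewrite /first_half /second_half in chl *; case: ifPn chl => hv chl.
- case=> mp'; (eexists m, l, _; split; last exact: mp').
  + by apply: admissible_vertical_half a hv _; lra.
  + by apply: descendants_child; rewrite chl; left.
  + by apply: admissible_vertical_half a hv _; lra.
  + by apply: descendants_child; rewrite chl; right.
- move=> _; have [_ /andP[+ _]] := admissible_horizontal_half 0%N a hv.
  by rewrite two_powB1; lra.
- case=> mp'; (eexists m, l, _; split; last exact: mp').
  + by apply: admissible_vertical_half a hv _; lra.
  + by apply: descendants_child; rewrite chl; left.
  + by apply: admissible_vertical_half a hv _; lra.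
  + by apply: descendants_child; rewrite chl; right.
have hn' : 2 ^ (l - 1 - 1) < expR u * sinh (2 * r) * 2 ^+ n.+1.
  by rewrite two_powB1; move: hn; rewrite (exprS _ n.+1); lra.
case=> mp'.
  have [m' [l' [u' [a' d' p']]]] := IH _ _ (admissible_horizontal_half _ a hv) mp' hn'.
  exists m', l', u'; split => //; apply: descendants_trans d'.
  by apply: descendants_child; rewrite chl; left.
have [m' [l' [u' [a' d' p']]]] := IH _ _ (admissible_horizontal_half _ a hv) mp' hn'.
exists m', l', u'; split => //; apply: descendants_trans d'.
by apply: descendants_child; rewrite chl; right.
Qed.

Lemma small_descendants (children : set (Gspace R) -> set (set (Gspace R)))
  m l u r p (eps : R) :
  (forall m l u r, admissible m l u r ->
    children (rectangle m l u r) = [set first_half m l u r; second_half m l u r]) ->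
  admissible m l u r -> rectangle m l u r p -> 0 < eps ->
  exists m' l' u' r', [/\ admissible m' l' u' r',
    descendants children (rectangle m l u r) (rectangle m' l' u' r'),
    rectangle m' l' u' r' p & r' <= eps].
Proof.
move=> hch a mp e0.
have [n] : exists n, r <= eps * 2 ^+ n.
  have r0 : 0 <= r / eps by case: a => r0 _; rewrite divr_ge0// ltW.
  exists (Num.truncn (r / eps)).+1; rewrite mulrC -ler_pdivrMr//.
  apply/ltW; apply: (lt_trans (truncnS_gt _)).
  by rewrite -natrX ltr_nat ltn_expl.
elim: n m l u r a mp => [|n IH] m l u r a mp rn.
  exists m, l, u, r; split => //; last by rewrite expr0 mulr1 in rn.
  exact: descendants_refl.
have c0 : 0 < expR u * sinh (2 * r).
  by rewrite mulr_gt0 ?expR_gt0// sinh_gt0//; case: a => r0 _; lra.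
have [k hk] : exists k, 2 ^ (l - 1) < expR u * sinh (2 * r) * 2 ^+ k.+1.
  exists (Num.truncn (2 ^ (l - 1) / (expR u * sinh (2 * r)))).
  rewrite mulrC -ltr_pdivrMr//; apply: (lt_trans (truncnS_gt _)).
  by rewrite -natrX ltr_nat ltn_expl.
have [m1 [l1 [u1 [a1 d1 p1]]]] := vertical_halving hch a mp hk.
have r1 : r / 2 <= eps * 2 ^+ n by move: rn; rewrite exprS; lra.
have [m2 [l2 [u2 [r2 [a2 d2 p2 re]]]]] := IH _ _ _ _ a1 p1 r1.
by exists m2, l2, u2, r2; split => //; exact: descendants_trans d2.
Qed.

End bisection.

Section halves_partition.
Context {R : realType}.

Lemma pair_card (T : Type) (A B : set T) : A !=set0 -> A `&` B = set0 ->
  ([set A; B] #= `I_2)%card.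
Proof.
move=> [x Ax] AB; pose f n := if n == 0%N then A else B.
have -> : [set A; B] = f @` `I_2.
  apply/seteqP; split => [C [->|->]|_ [[|[|//]] _ <-]]; [by exists 0%N|by exists 1%N|by left|by right].
apply: inj_card_eq => i j /set_mem/= + /set_mem/=.
case: i => [|[|//]]; case: j => [|[|//]] // _ _; rewrite /f/= => e.
  by exfalso; move: Ax; rewrite -[A]setIid {2}e AB.
by exfalso; move: Ax; rewrite -[A]setIid -{2}e AB.
Qed.

Lemma quasi_partition_halves (nu : R) m l u r : admissible m l u r ->
  quasi_partition (mu_bar nu) (rectangle m l u r)
    [set first_half m l u r; second_half m l u r].
Proof.
move=> a; have r0 : 0 < r by case: a.
have U := setU_halves m l u r0; have I := setI_halves m l u r.
have [al ar] := halves_admissible a.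
have mr (A : set (Gspace R)) : adm_rectangles A -> measurable (A : set (borelType (Gspace R))).
  by move=> [? [? [? [? [_ _ ->]]]]]; exact: measurable_rectangle.
split.
- exact: finite_set_countable.
- move=> A B [->|->] [->|->] [x xAB] //; exfalso; case: xAB => /= x1 x2;
  by have : (first_half m l u r `&` second_half m l u r) x by []; rewrite I.
- by move=> A [->|->]; split; [exact: mr|rewrite -U => ?; left|exact: mr|rewrite -U => ?; right].
- rewrite (_ : _ `\` _ = set0); first exact: negligible_set0.
  rewrite -subset0 => p []; rewrite -U => -[h|h]; apply.
    by exists (first_half m l u r) => //; left.
  by exists (second_half m l u r) => //; right.
Qed.

End halves_partition.

Section rectangle_parameters.
Context {R : realType}.
Implicit Types (m : nat) (l : int) (u r : R) (A : set (Gspace R)).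

Definition rect_params A : nat * int * R * R :=
  xget (0%N, 0, 0, 0) [set q | 0 < q.2 /\
    A = rectangle q.1.1.1 q.1.1.2 q.1.2 q.2].

Lemma rect_paramsE m l u r : 0 < r ->
  rect_params (rectangle m l u r) = (m, l, u, r).
Proof.
move=> r0; rewrite /rect_params; case: xgetP => [q _ [q0 e]|/(_ (m, l, u, r))].
  have [-> -> -> ->] := rectangle_inj r0 q0 e.
  by rewrite -!surjective_pairing.
by case.
Qed.

Definition adm_center A : Gspace R :=
  let: (m, l, u, r) := rect_params A in rect_center m l u.
Definition adm_radius A : R := (rect_params A).2.
Definition adm_children A : set (set (Gspace R)) :=
  let: (m, l, u, r) := rect_params A in
  [set first_half m l u r; second_half m l u r].

Lemma adm_radiusE m l u r : 0 < r -> adm_radius (rectangle m l u r) = r.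
Proof. by move=> r0; rewrite /adm_radius rect_paramsE. Qed.

Lemma adm_childrenE m l u r : 0 < r -> adm_children (rectangle m l u r) =
  [set first_half m l u r; second_half m l u r].
Proof. by move=> r0; rewrite /adm_children rect_paramsE. Qed.

Lemma adm_rectanglesP A : adm_rectangles A -> exists m l u r,
  admissible m l u r /\ A = rectangle m l u r.
Proof. by move=> [m [l [u [r [r0 h ->]]]]]; exists m, l, u, r. Qed.

Lemma adm_of_admissible m l u r : admissible m l u r ->
  adm_rectangles (rectangle m l u r).
Proof. by move=> [r0 h]; exists m, l, u, r. Qed.

End rectangle_parameters.

(** * Comparison of masses *)

Section measure_comparison.
Context {R : realType}.
Variable nu : R.
Hypothesis nu1 : 1 <= nu.
Implicit Types (m : nat) (l : int) (u r : R) (A B : set (Gspace R)).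

(** The 20 comes from the enclosing ball; the power of 4 compares the densities at
abscissas whose ratio is at most 4. *)
Definition kappa : R := 20 * 4 `^ nu.

Lemma kappa_ge m : (m <= 80)%N -> m%:R * 4 `^ (nu - 1) <= kappa.
Proof.
move=> m80; have -> : kappa = 80 * 4 `^ (nu - 1).
  rewrite /kappa -[in LHS](subrK 1 nu) (@powRD _ _ (nu - 1) 1); last first.
    by apply/implyP => _; rewrite pnatr_eq0.
  by rewrite powRr1//; lra.
by rewrite ler_wpM2r ?powR_ge0// ler_nat.
Qed.

Lemma kappa_ge20 : 20 <= kappa.
Proof.
apply: le_trans (@kappa_ge 20 isT); rewrite ler_peMr//.
by rewrite -[leLHS](powRr0 4) ler_powR ?subr_ge0// ler1n.
Qed.

Lemma mu_bar_compare A B (a b c d a' b' c' d' : R) :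
  measurable (A : set (borelType (Gspace R))) ->
  measurable (B : set (borelType (Gspace R))) ->
  A `<=` Gbox a b c d -> Gbox a' b' c' d' `<=` B ->
  a <= b -> c <= d -> 0 <= a' -> a' <= b' -> c' <= d' ->
  0 <= b -> b <= 4 * a' ->
  (b - a) * (d - c) <= 8 * ((b' - a') * (d' - c')) ->
  (mu_bar nu A <= kappa%:E * mu_bar nu B)%E.
Proof.
move=> mA mB sA sB ab cd a'0 a'b' c'd' b0 ba' V.
apply: (le_trans (mu_bar_le nu1 mA b0 ab cd sA)).
have := mu_bar_ge nu1 mB a'0 a'b' c'd' sB.
have k0 : (0 <= kappa%:E :> \bar R)%E by rewrite lee_fin; have := kappa_ge20; lra.
move=> /(lee_wpmul2l k0); apply: le_trans; rewrite -EFinM lee_fin.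
have V'0 : 0 <= (b' - a') * (d' - c') by rewrite mulr_ge0// subr_ge0.
have p : b `^ (nu - 1) <= 4 `^ (nu - 1) * a' `^ (nu - 1).
  rewrite -powRM//; apply: ge0_ler_powR => //; rewrite ?nnegrE ?subr_ge0//.
  by rewrite mulr_ge0.
apply: (@le_trans _ _ (4 `^ (nu - 1) * a' `^ (nu - 1) * (8 * ((b' - a') * (d' - c'))))).
  by apply: ler_pM => //; [exact: powR_ge0|rewrite mulr_ge0// subr_ge0].
have -> : 4 `^ (nu - 1) * a' `^ (nu - 1) * (8 * ((b' - a') * (d' - c'))) =
  8%:R * 4 `^ (nu - 1) * (a' `^ (nu - 1) * ((b' - a') * (d' - c'))) by ring.
by rewrite ler_wpM2r ?kappa_ge// mulr_ge0// powR_ge0.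
Qed.

(** The right half of a rectangle, where the density is bounded below even when
m = 0. *)
Lemma rectangle_core m l u r : 0 < r ->
  Gbox ((m%:R + 1/2) * 2 ^ l) (m.+1%:R * 2 ^ l) (u - r) (u + r) `<=` rectangle m l u r.
Proof.
move=> r0 p [/andP[p1 p2] pu]; split => //; apply/andP; split=> //.
by apply: le_trans p1; rewrite ler_pM2r ?two_pow_gt0//; lra.
Qed.

Lemma mu_bar_compare_rect A m l u r (a b c d : R) :
  measurable (A : set (borelType (Gspace R))) -> 0 < r ->
  A `<=` Gbox a b c d -> a <= b -> c <= d ->
  0 <= b -> b <= 4 * ((m%:R + 1/2) * 2 ^ l) ->
  (b - a) * (d - c) <= 8 * (2 ^ l * r) ->
  (mu_bar nu A <= kappa%:E * mu_bar nu (rectangle m l u r))%E.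
Proof.
move=> mA r0 sA ab cd b0 hb V; have w0 := @two_pow_gt0 R l.
have mn : 0 <= m%:R :> R := ler0n _ _.
apply: (mu_bar_compare mA (measurable_rectangle _ _ _ _) sA (@rectangle_core m l u r r0)) => //.
- by rewrite mulr_ge0//; lra.
- by rewrite ler_pM2r// -(natr1 m); lra.
- lra.
- by apply: le_trans V _; rewrite -(natr1 m); lra.
Qed.

Lemma mu_bar_rect_gt0 m l u r : 0 < r -> (0 < mu_bar nu (rectangle m l u r))%E.
Proof.
move=> r0; have w0 := @two_pow_gt0 R l; have mn : 0 <= m%:R :> R := ler0n _ _.
apply: lt_le_trans (mu_bar_ge nu1 (measurable_rectangle _ _ _ _) _ _ _
  (@rectangle_core m l u r r0)).
- rewrite lte_fin !mulr_gt0//; [|by rewrite -(natr1 m); lra|lra].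
  by rewrite powR_gt0// mulr_gt0//; lra.
- by rewrite mulr_ge0//; lra.
- by rewrite ler_pM2r// -(natr1 m); lra.
- lra.
Qed.

Lemma mu_bar_rect_fin m l u r : 0 < r -> (mu_bar nu (rectangle m l u r) < +oo)%E.
Proof.
move=> r0; have w0 := @two_pow_gt0 R l; have mn : 0 <= m%:R :> R := ler0n _ _.
apply: le_lt_trans (mu_bar_le nu1 (measurable_rectangle _ _ _ _) _ _ _
  (subsetW (rectangleE m l u r))) _.
- by rewrite mulr_ge0//; lra.
- by rewrite ler_pM2r// -(natr1 m); lra.
- lra.
- exact: ltry.
Qed.

Lemma mu_bar_enlargement m l u r : admissible m l u r ->
  (mu_bar nu (enlargement adm_radius (rectangle m l u r)) <=
   kappa%:E * mu_bar nu (rectangle m l u r))%E.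
Proof.
move=> a; have r0 : 0 < r by case: a.
have w0 := @two_pow_gt0 R l; have mn : 0 <= m%:R :> R := ler0n _ _.
have mw := mulr_ge0 mn (ltW w0).
rewrite enlargementE ?adm_radiusE//.
apply: (@mu_bar_compare_rect _ m l u r _ _ _ _ _ r0 (thickening_rectangle a)).
- exact: open_borel (open_thickening _ _).
- by rewrite ler_pM2r//; lra.
- lra.
- by rewrite mulr_ge0//; lra.
- lra.
- lra.
Qed.

Lemma mu_bar_halves m l u r : 0 < r ->
  (mu_bar nu (rectangle m l u r) <= kappa%:E * mu_bar nu (first_half m l u r))%E /\
  (mu_bar nu (rectangle m l u r) <= kappa%:E * mu_bar nu (second_half m l u r))%E.
Proof.
move=> r0; have w0 := @two_pow_gt0 R l; have mn : 0 <= m%:R :> R := ler0n _ _.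
have mw := mulr_ge0 mn (ltW w0).
have wr := mulr_gt0 w0 r0.
rewrite /first_half /second_half; case: ifPn => _.
  by split; (apply: (@mu_bar_compare_rect _ _ _ _ _ _ _ _ _ (measurable_rectangle _ _ _ _) _
      (subsetW (rectangleE m l u r))); rewrite -?(natr1 m)); lra.
split; (apply: (@mu_bar_compare_rect _ _ _ _ _ _ _ _ _ (measurable_rectangle _ _ _ _) _
      (subsetW (rectangleE m l u r))); rewrite ?two_powB1 -?(natr1 m) -?(natr1 m.*2) -?muln2 ?natrM); lra.
Qed.

End measure_comparison.

(** * Partitions into large rectangles *)

Section large_rectangles.
Context {R : realType}.
Implicit Types (m n k : nat) (l : int) (u r v a : R).

Lemma ln2_ge : 1 / 2 <= ln 2 :> R.
Proof.
rewrite -ler_expR lnK ?posrE// -[leRHS]invrK -[leLHS]invrK.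
rewrite lef_pV2 ?posrE ?invr_gt0 ?expR_gt0// -expRN.
by have := expR_ge1Dx (- (1 / 2) : R); lra.
Qed.

Lemma expR_lt_sinh r : 1 / 2 <= r -> expR (2 * r) < sinh (9 * r).
Proof.
move=> r1; rewrite /sinh (_ : 9 * r = 2 * r + 7 * r); last lra.
rewrite expRD; have := expR_ge1Dx (7 * r).
have : expR (- (2 * r + 7 * r)) <= 1 by rewrite -[leRHS]expR0 ler_expR; lra.
have : 1 <= expR (2 * r) by rewrite -[leLHS]expR0 ler_expR; lra.
by nra.
Qed.

(** Here 2^(l-1) = e^(u + 2r), so both admissibility bounds depend on r alone. *)
Lemma admissible_pow m n u r : 1 / 2 <= r -> u + 2 * r = n%:R * ln 2 ->
  admissible m (n%:Z + 1) u r.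
Proof.
move=> r1 e; have e2 : 2 ^ (n%:Z + 1 - 1) = expR u * expR (2 * r) :> R.
  by rewrite addrK -expRD e mulrC expRM_natr lnK ?posrE.
split; first lra.
rewrite e2 ler_pM2l ?expR_gt0// ltr_pM2l ?expR_gt0// expR_lt_sinh// andbT.
apply: le_trans (sinh_le_expR _) _; have := expR_gt0 (2 * r); lra.
Qed.

Lemma mu_bar_rect_large (nu : R) m n u r : 1 <= nu -> 0 < r ->
  ((2 * r)%:E <= mu_bar nu (rectangle m (n%:Z + 1) u r))%E.
Proof.
move=> nu1 r0; set w := 2 ^ (n%:Z + 1) : R.
have w2 : 2 <= w.
  by rewrite /w expfzDr// expr1z -exprnP ler_peMl// exprn_ege1// ler1n.
have mn : 0 <= m%:R :> R := ler0n _ _.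
apply: le_trans (mu_bar_ge nu1 (measurable_rectangle _ _ _ _) _ _ _
  (@rectangle_core _ m (n%:Z + 1) u r r0)); rewrite -/w.
- rewrite lee_fin -[leLHS]mul1r.
  have h1 : 1 <= (m%:R + 1 / 2) * w by nra.
  apply: ler_pM => //; first lra.
    apply: (@le_trans _ _ (1 `^ (nu - 1))); first by rewrite powR1.
    by rewrite ge0_ler_powR ?nnegrE ?subr_ge0//; lra.
  by rewrite -(natr1 m); nra.
- by rewrite mulr_ge0//; lra.
- by rewrite ler_pM2r -?(natr1 m); lra.
- lra.
Qed.

End large_rectangles.

Section partition.
Context {R : realType}.
Variables (I : countType) (l : I -> int) (u r : I -> R).
Hypothesis strips_disjoint : forall i j v,
  u i - r i <= v < u i + r i -> u j - r j <= v < u j + r j -> i = j.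
Hypothesis strips_cover : forall v, exists i, u i - r i <= v < u i + r i.

Definition strip_rectangles : set (set (Gspace R)) :=
  range (fun q : I * nat => rectangle q.2 (l q.1) (u q.1) (r q.1)).

(** A partition of the line into strips gives a partition of the half-plane into
rectangles, whatever width is chosen in each strip. *)
Lemma quasi_partition_strips (nu : R) :
  quasi_partition (mu_bar nu) [set: Gspace R] strip_rectangles.
Proof.
split.
- by apply: (sub_countable (card_image_le _ _)); exact: countableP.
- move=> _ _ [[i m] _ <-] [[j m'] _ <-] [p [/= [/andP[a1 a2] a3] [/andP[b1 b2] b3]]].
  have ij := strips_disjoint a3 b3; rewrite ij in a1 a2 *.
  have w0 := @two_pow_gt0 R (l j).
  have := le_lt_trans a1 b2; have := le_lt_trans b1 a2.
  rewrite !ltr_pM2r// !ltr_nat !ltnS => mm' m'm.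
  by rewrite (@anti_leq m m')// mm' m'm.
- by move=> _ [[i m] _ <-]; split => //; exact: measurable_rectangle.
- rewrite (_ : _ `\` _ = set0); first exact: negligible_set0.
  rewrite -subset0 => p [_]; apply.
  have [i hi] := strips_cover (val p).2.
  have w0 := @two_pow_gt0 R (l i).
  have pw : 0 <= (val p).1 / 2 ^ l i 
    by apply: divr_ge0 (ltW w0); exact: (valP p).
  exists (rectangle (Num.truncn ((val p).1 / 2 ^ l i)) (l i) (u i) (r i)).
    by exists (i, Num.truncn ((val p).1 / 2 ^ l i)).
  split => //.
  by rewrite -ler_pdivlMr// -ltr_pdivrMr// truncn_itv.
Qed.

End partition.

Section large_partition.
Context {R : realType}.
Variable N : nat.
Hypothesis N0 : (0 < N)%N.
Let a : R := N%:R * ln 2.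

Let a_ge : N%:R / 2 <= a.
Proof. by rewrite ler_wpM2l//; have := @ln2_ge R; lra. Qed.

Let a_ge_half : 1 / 2 <= a.
Proof. by apply: le_trans a_ge; rewrite ler_wpM2r// ler1n. Qed.

Let a0 : 0 < a. Proof. by have := a_ge_half; lra. Qed.

(** The strip of index (true, k) is [2k a, (2k+2) a), and the strip of index
(false, k) is [(1 - 3^(k+1)) a, (1 - 3^k) a). The radius 3^k a below 0 is what
keeps u + 2r, hence the width, constant. *)
Definition strip_exponent (i : bool * nat) : nat :=
  if i.1 then (N * (2 * i.2 + 3))%N else N.
Definition strip_mid (i : bool * nat) : R :=
  if i.1 then (2 * i.2%:R + 1) * a else (1 - 2 * 3 ^+ i.2) * a.
Definition strip_radius (i : bool * nat) : R :=
  if i.1 then a else 3 ^+ i.2 * a.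

Lemma strip_radius_ge i : N%:R / 2 <= strip_radius i.
Proof.
rewrite /strip_radius; case: i.1 => //; apply: le_trans a_ge _.
by rewrite ler_peMl ?exprn_ege1 ?ler1n// ltW.
Qed.

Lemma strip_radius_ge_half i : 1 / 2 <= strip_radius i.
Proof. by apply: le_trans (strip_radius_ge i); rewrite ler_wpM2r// ler1n. Qed.

Lemma strip_admissible m i :
  admissible m ((strip_exponent i)%:Z + 1) (strip_mid i) (strip_radius i).
Proof.
apply: admissible_pow; first exact: strip_radius_ge_half.
rewrite /strip_mid /strip_radius /strip_exponent; case: i.1; rewrite /a; last by ring.
by rewrite natrM natrD natrM; ring.
Qed.

Let strip (i : bool * nat) (v : R) :=
  strip_mid i - strip_radius i <= v < strip_mid i + strip_radius i.

Let upper_strip k v : strip (true, k) v = (2 * k%:R * a <= v < 2 * k.+1%:R * a).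
Proof.
by rewrite /strip /strip_mid /strip_radius/= -(natr1 k); congr ((_ <= v) && (v < _)); ring.
Qed.

Let lower_strip k v :
  strip (false, k) v = ((1 - 3 ^+ k.+1) * a <= v < (1 - 3 ^+ k) * a).
Proof.
by rewrite /strip /strip_mid /strip_radius/= exprS; congr ((_ <= v) && (v < _)); ring.
Qed.

Let upper_strip_ge0 k v : strip (true, k) v -> 0 <= v.
Proof. by rewrite upper_strip => /andP[h _]; apply: le_trans h; apply: mulr_ge0 (ltW a0); exact: mulr_ge0. Qed.

Let lower_strip_lt0 k v : strip (false, k) v -> v < 0.
Proof.
rewrite lower_strip => /andP[_ h]; apply: (lt_le_trans h).
by rewrite mulr_le0_ge0 ?subr_le0 ?exprn_ege1 ?ler1n// ltW.
Qed.

Let upper_strip_le k k' v : strip (true, k) v -> strip (true, k') v -> (k <= k')%N.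
Proof.
rewrite !upper_strip => /andP[h _] /andP[_ h'].
have := le_lt_trans h h'; rewrite ltr_pM2r// ltr_pM2l// ltr_nat ltnS//.
Qed.

Let lower_strip_le k k' v : strip (false, k) v -> strip (false, k') v -> (k <= k')%N.
Proof.
rewrite !lower_strip => /andP[_ h] /andP[h' _].
have := le_lt_trans h' h; rewrite ltr_pM2r// ltrD2l ltrN2 ltr_eXn2l ?ltr1n//.
Qed.

Lemma strips_disjoint i j v : strip i v -> strip j v -> i = j.
Proof.
case: i j => [[] k] [[] k'] hi hj.
- by congr pair; apply/eqP; rewrite eqn_leq (upper_strip_le hi hj) (upper_strip_le hj hi).
- by have := le_lt_trans (upper_strip_ge0 hi) (lower_strip_lt0 hj); rewrite ltxx.
- by have := le_lt_trans (upper_strip_ge0 hj) (lower_strip_lt0 hi); rewrite ltxx.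
- by congr pair; apply/eqP; rewrite eqn_leq (lower_strip_le hi hj) (lower_strip_le hj hi).
Qed.

Lemma strips_cover v : exists i, strip i v.
Proof.
have [v0|v0] := leP 0 v.
  exists (true, Num.truncn (v / (2 * a))); rewrite upper_strip.
  have a20 : 0 < 2 * a by apply: mulr_gt0.
  have e (x : R) : 2 * x * a = x * (2 * a) by rewrite mulrAC mulrC.
  rewrite !e -ler_pdivlMr// -ltr_pdivrMr//.
  by rewrite truncn_itv//; apply: divr_ge0 (ltW a20).
have ex : exists k, (1 - 3 ^+ k.+1) * a <= v.
  have h0 : 0 <= - v / a by rewrite divr_ge0 ?oppr_ge0// ltW.
  exists (Num.truncn (- v / a)); set k := Num.truncn _.
  have hk : - v < k.+1%:R * a.
    by rewrite -ltr_pdivrMr//; exact: truncnS_gt.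
  have h3 : k.+2%:R * a <= 3 ^+ k.+1 * a.
    by rewrite ler_pM2r// -natrX ler_nat ltn_expl.
  by move: h3; rewrite -(natr1 k.+1); move: (3 ^+ k.+1) => x; lra.
case: (ex_minnP ex) => k hk kmin; exists (false, k); rewrite lower_strip hk/=.
rewrite ltNge; apply/negP; case: k hk kmin => [|k] hk kmin h.
  by move: h; rewrite expr0 subrr mul0r; lra.
by have := kmin k h; rewrite ltnn.
Qed.

End large_partition.

(** * Condition (C) *)

Section condition_C.
Context {R : realType}.

Let chain (k : nat) : set (Gspace R) :=
  rectangle 0 ((2 * k.+1)%:Z + 1) 0 (k.+1%:R * ln 2).

Let ln2_ge0 : 0 <= ln 2 :> R. Proof. by have := @ln2_ge R; lra. Qed.

Let chainE k : chain k = Gbox 0 (2 ^+ (2 * k.+1).+1) (- (k.+1%:R * ln 2)) (k.+1%:R * ln 2).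
Proof.
by rewrite /chain rectangleE mul0r mul1r sub0r add0r -PoszD addn1.
Qed.

Let chainS k k' : (k <= k')%N -> chain k `<=` chain k'.
Proof.
move=> kk'; rewrite !chainE => p [/andP[p1 p2] /andP[p3 p4]].
have h1 : 2 ^+ (2 * k.+1).+1 <= 2 ^+ (2 * k'.+1).+1 :> R.
  by rewrite ler_weXn2l ?ler1n// ltnS leq_mul2l ltnS kk'.
have h2 : k.+1%:R * ln 2 <= k'.+1%:R * ln 2 :> R by rewrite ler_wpM2r// ler_nat ltnS.
by split; lra.
Qed.

Lemma condition_C_adm_rectangles : condition_C (@adm_rectangles R).
Proof.
exists (range chain); split.
- move=> _ [k _ <-]; apply: adm_of_admissible; apply: admissible_pow.
    have : 1 <= k.+1%:R :> R by rewrite ler1n.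
    by have := @ln2_ge R; nra.
  by rewrite natrM; ring.
- move=> A [m [l [u [r [r0 _ ->]]]]].
  set M : R := m.+1%:R * 2 ^ l + 2 * (`|u| + r).
  have w0 : 0 < m.+1%:R * 2 ^ l :> R by rewrite mulr_gt0 ?ltr0n// two_pow_gt0.
  have u0 := normr_ge0 u.
  exists (chain (Num.truncn M)); first by exists (Num.truncn M).
  have := truncnS_gt M; set n := Num.truncn M => Mn.
  have h1 : n.+1%:R <= 2 ^+ (2 * n.+1).+1 :> R.
    rewrite -natrX ler_nat (leq_trans (ltnW (ltn_expl n.+1 (ltnSn 1))))// leq_exp2l//.
    by rewrite leqW// leq_pmull.
  have h2 : n.+1%:R / 2 <= n.+1%:R * ln 2 :> R.
    by rewrite ler_wpM2l//; have := @ln2_ge R; lra.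
  have := ler_norm u; have := ler_norm (- u); rewrite normrN => nu un.
  rewrite chainE => p [/andP[p1 p2] /andP[p3 p4]].
  have := valP p; rewrite /= => p0; split; rewrite ?p0/=; rewrite /M in Mn; lra.
- move=> _ _ [k _ <-] [k' _ <-] _.
  by case: (leqP k k') => [|/ltnW] /chainS; [left|right].
Qed.

End condition_C.

(** * The Calderon-Zygmund axioms *)

Lemma cz_axioms_adm_rectangles (R : realType) (nu : R) : 1 <= nu ->
  cz_axioms (mu_bar nu) (@adm_rectangles R) (kappa nu) (@adm_center R) (@adm_radius R)
    (@adm_children R).
Proof.
move=> nu1; have k20 := kappa_ge20 nu1.
have hch m l u r : admissible m l u r -> adm_children (rectangle m l u r) =
  [set @first_half R m l u r; second_half m l u r].
  by case=> r0 _; exact: adm_childrenE.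
split.
- by move=> _ /adm_rectanglesP[m [l [u [r [[r0 _] ->]]]]]; rewrite adm_radiusE.
- move=> _ /adm_rectanglesP[m [l [u [r [a ->]]]]]; have r0 : 0 < r by case: a.
  rewrite /adm_center /adm_radius rect_paramsE//=.
  apply: (subset_trans (rectangle_sub_ball a)).
  by apply: le_ball; rewrite ler_pM2r.
- move=> _ /adm_rectanglesP[m [l [u [r [a ->]]]]]; have r0 : 0 < r by case: a.
  split; last 2 first.
  + exact: mu_bar_enlargement.
  + by rewrite lte_mul_pinfty ?lee_fin ?mu_bar_rect_fin//; lra.
  + apply: (lt_le_trans (mu_bar_rect_gt0 nu1 m l u r0)).
    have mE : measurable (enlargement adm_radius (rectangle m l u r) : set (borelType (Gspace R))).
      by rewrite enlargementE ?adm_radiusE//; exact: open_borel (open_thickening _ _).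
    apply: (le_measure (mu_bar nu) (mem_set (measurable_rectangle m l u r)) (mem_set mE)).
    by rewrite enlargementE ?adm_radiusE//; exact: sub_thickening.
- move=> _ /adm_rectanglesP[m [l [u [r [a ->]]]]]; have r0 : 0 < r by case: a.
  rewrite hch//; have [al ar] := halves_admissible a.
  have [ml mr] := mu_bar_halves nu1 m l u r0.
  split.
  + by move=> _ [->|->].
  + exact: quasi_partition_halves.
  + exists 2%N; split; last lra.
    apply: pair_card; first exact: adm_rectangle_neq0.
    exact: setI_halves.
  + by move=> _ [->|->].
- move=> eps _ e0 /adm_rectanglesP[m [l [u [r [a ->]]]]]; apply: aeW => p mp.
  have [m' [l' [u' [r' [a' d' p' re]]]]] := small_descendants hch a mp e0.
  exists (rectangle m' l' u' r'); split => //.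
  by rewrite adm_radiusE//; case: a'.
- move=> lam lam0 _; pose N := (Num.truncn lam).+1; have N0 : (0 < N)%N by [].
  exists (strip_rectangles (fun i => (strip_exponent N i)%:Z + 1)
    (@strip_mid R N) (@strip_radius R N)); split.
  + by move=> _ [[i m] _ <-]; apply: adm_of_admissible; exact: strip_admissible.
  + by apply: quasi_partition_strips; [exact: strips_disjoint|exact: strips_cover].
  + move=> _ [[i m] _ <-] /=.
    have rN := @strip_radius_ge R N N0 i; have lN : lam < N%:R := truncnS_gt lam.
    apply: lt_le_trans (mu_bar_rect_large _ _ _ nu1 _); last lra.
    by rewrite lte_fin; lra.
Qed.

Theorem theorem3p11 (R : realType) (nu : R) (hnu : 1 <= nu) :
  restrictive_cz_space (mu_bar nu) (@adm_rectangles R) /\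
  condition_C (@adm_rectangles R).
Proof.
split; last exact: condition_C_adm_rectangles.
split.
- exact: radon_mu_bar.
- by move=> _ [m [l [u [r [_ _ ->]]]]]; exact: measurable_rectangle.
- exists (kappa nu), (@adm_center R), (@adm_radius R), (@adm_children R); split.
    by have := kappa_ge20 hnu; lra.
  exact: cz_axioms_adm_rectangles.
Qed.
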